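(* In the logistic fictitious play (LFP) algorithm described in the context, choose any initial actions $i_0\in[n]$ and $j_0\in[m]$, and step-sizes $\alpha_t=2/(t+2)$ for all $t\ge0$. Then for any $\delta\in(0,1)$ there exists $T(\delta)<+\infty$ (a nonnegative integer) such that $\Pr(\mathcal{A}_{T(\delta)})\ge 1-\delta$ and $$\mathbb{E}\big[\Delta(x^t,y^t)\,\big|\,\mathcal{A}_{T(\delta)}\big]\le\frac{T(\delta)(T(\delta)+1)}{t(t+1)}\,\Delta_{\max}+\frac{8\eta\,(L_{\mathsf{x}}+L_{\mathsf{y}}+2\kappa)\,(t-T(\delta))}{t(t+1)},\qquad\forall\,t\ge T(\delta)+1,$$ where $\kappa=\|A\|_{1,\infty}^2/\eta^2$, and $\mathcal{A}_T$, $\Delta$, $\Delta_{\max}$, $L_{\mathsf{x}}$, $L_{\mathsf{y}}$ are as defined in the context.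
   Context: Notation. $[n]:=\{1,\ldots,n\}$; $e_i$ is the $i$-th standard coordinate vector; $\Delta_n:=\{x\in\mathbb{R}^n_+:\sum_{i=1}^n x_i=1\}$ is the probability simplex; $\mathrm{ri}$ denotes relative interior; $e$ is the all-ones vector. $A\in\mathbb{R}^{m\times n}$ is a payoff matrix with entries $a_{j,i}$, $j$-th row $a_j^\top$ and $i$-th column $A_i$; $\|A\|_{1,\infty}:=\sup_{\|z\|_1=1}\|Az\|_\infty=\max_{j\in[m],i\in[n]}|a_{j,i}|$. $\eta>0$ is a regularization parameter. The (negative) entropies are $h_{\mathsf{x}}(x):=\sum_{i=1}^n x_i\ln x_i$ for $x\in\mathbb{R}^n_+$ and $h_{\mathsf{y}}(y):=\sum_{j=1}^m y_j\ln y_j$ for $y\in\mathbb{R}^m_+$ (with $0\ln 0=0$). Best-logit-response maps: $\mathsf{P}_{\mathsf{x}}(y):=\arg\min_{x\in\Delta_n}\langle A^\top y,x\rangle+\eta h_{\mathsf{x}}(x)$ and $\mathsf{P}_{\mathsf{y}}(x):=\arg\max_{y\in\Delta_m}\langle Ax,y\rangle-\eta h_{\mathsf{y}}(y)$. LFP algorithm: given initial actions $i_0\in[n]$, $j_0\in[m]$ and (deterministic) step-sizes $\{\alpha_t\}_{t\ge0}\subseteq(0,1]$, set $x^0:=e_{i_0}$, $y^0:=e_{j_0}$. At each $t=0,1,2,\ldots$, let $w^t:=\mathsf{P}_{\mathsf{x}}(y^t)$ and $s^t:=\mathsf{P}_{\mathsf{y}}(x^t)$; sample $i_{t+1}\in[n]$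 from the distribution $w^t$ and $j_{t+1}\in[m]$ from the distribution $s^t$ (that is, conditionally on $\mathcal{F}_t:=\sigma(\{(x^i,y^i)\}_{i=0}^t)$, $\Pr(i_{t+1}=i)=w^t_i$ and $\Pr(j_{t+1}=j)=s^t_j$); set $x^{t+1}:=(1-\alpha_t)x^t+\alpha_t e_{i_{t+1}}$ and $y^{t+1}:=(1-\alpha_t)y^t+\alpha_t e_{j_{t+1}}$. Fixed point and neighborhood: $(x^*,y^* )\in\mathrm{ri}\,\Delta_n\times\mathrm{ri}\,\Delta_m$ denotes the unique solution of $\mathsf{P}_{\mathsf{x}}(y)=x$, $\mathsf{P}_{\mathsf{y}}(x)=y$. Fix radii $r_{\mathsf{x}},r_{\mathsf{y}}>0$ such that $\mathcal{N}(x^*,y^* ):=\mathcal{B}_{r_{\mathsf{x}}}(x^* )\times\mathcal{B}_{r_{\mathsf{y}}}(y^* )\subseteq\mathrm{ri}\,\Delta_n\times\mathrm{ri}\,\Delta_m$, where $\mathcal{B}_{r_{\mathsf{x}}}(x^* ):=\{x\in\mathbb{R}^n:e^\top x=1,\ \|x-x^*\|_1\le r_{\mathsf{x}}\}$ and $\mathcal{B}_{r_{\mathsf{y}}}(y^* ):=\{y\in\mathbb{R}^m:e^\top y=1,\ \|y-y^*\|_1\le r_{\mathsf{y}}\}$. Events: $\mathcal{A}_T:=\{\forall\,t\ge T,\ (x^t,y^t)\in\mathcal{N}(x^*,y^* )\}$ for integers $T\ge0$. Constants: $L_{\mathsf{x}},L_{\mathsf{y}}\ge0$ are finite constants such that $h_{\mathsf{x}}(x')\le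 h_{\mathsf{x}}(x)+\langle\nabla h_{\mathsf{x}}(x),x'-x\rangle+(L_{\mathsf{x}}/2)\|x'-x\|_1^2$ for all $x,x'\in\mathcal{B}_{r_{\mathsf{x}}}(x^* )$, and $h_{\mathsf{y}}(y')\le h_{\mathsf{y}}(y)+\langle\nabla h_{\mathsf{y}}(y),y'-y\rangle+(L_{\mathsf{y}}/2)\|y'-y\|_1^2$ for all $y,y'\in\mathcal{B}_{r_{\mathsf{y}}}(y^* )$ (such constants exist). Duality gap: for $(x,y)\in\Delta_n\times\Delta_m$, $$\Delta(x,y)=\eta\ln\Big(\sum_{j=1}^m\exp(a_j^\top x/\eta)\Big)+\eta h_{\mathsf{x}}(x)+\eta\ln\Big(\sum_{i=1}^n\exp(-A_i^\top y/\eta)\Big)+\eta h_{\mathsf{y}}(y),$$ and $\Delta_{\max}:=\max_{(x,y)\in\Delta_n\times\Delta_m}\Delta(x,y)<+\infty$. *)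

(* Defs.v *)
From HB Require Import structures.
From mathcomp Require Import all_boot all_order all_algebra.
From mathcomp Require Import all_classical all_reals all_analysis.

Set Implicit Arguments.
Unset Strict Implicit.
Unset Printing Implicit Defensive.

Import Order.TTheory GRing.Theory Num.Theory.
Import numFieldNormedType.Exports.

Local Open Scope classical_set_scope.
Local Open Scope ring_scope.

Section Geometry.
Context {R : realType}.

Definition affine_hull {V : normedModType R} (C : set V) : set V :=
  [set v : V | exists k (c : 'I_k -> R) (p : 'I_k -> V),
    [/\ forall i, C (p i), \sum_i c i = 1 & v = \sum_i c i *: p i]].

Definition relint {V : normedModType R} (C : set V) : set V :=
  [set v : V | C v /\ \forall z \near within (affine_hull C) (nbhs v), C z].

Definition argmin {T : pointedType} (C : set T) (f : T -> R) : T :=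
  get [set x : T | C x /\ forall x' : T, C x' -> f x <= f x'].

Definition argmax {T : pointedType} (C : set T) (f : T -> R) : T :=
  get [set x : T | C x /\ forall x' : T, C x' -> f x' <= f x].

Definition stdvec {n : nat} (i : 'I_n) : 'cV[R]_n := delta_mx i 0.

Definition dot {n : nat} (u v : 'cV[R]_n) : R := \sum_i u i 0 * v i 0.

Definition l1norm {n : nat} (v : 'cV[R]_n) : R := \sum_i `|v i 0|.

Definition simplex (n : nat) : set 'cV[R]_n :=
  [set x : 'cV[R]_n | (forall i, 0 <= x i 0) /\ \sum_i x i 0 = 1].

(* The ball is taken inside the affine hyperplane of the simplex, without
   requiring nonnegative coordinates. *)
Definition l1ball {n : nat} (c : 'cV[R]_n) (r : R) : set 'cV[R]_n :=
  [set x : 'cV[R]_n | \sum_i x i 0 = 1 /\ l1norm (x - c) <= r].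

Definition nbhd {n m : nat} (xs : 'cV[R]_n) (ys : 'cV[R]_m) (rx ry : R) :
    set ('cV[R]_n * 'cV[R]_m) :=
  l1ball xs rx `*` l1ball ys ry.

(* The library norm of the column A *m z is its largest absolute entry. *)
Definition norm_1oo {m n : nat} (A : 'M[R]_(m, n)) : R :=
  sup [set `|A *m z| | z in [set z : 'cV[R]_n | l1norm z = 1]].

Definition gradient {n : nat} (f : 'cV[R]_n -> R) (x : 'cV[R]_n) : 'cV[R]_n :=
  \col_i 'D_(stdvec i) f x.

Definition smooth_on {n : nat} (f : 'cV[R]_n -> R) (B : set 'cV[R]_n)
    (L : R) : Prop :=
  forall x x' : 'cV[R]_n, B x -> B x' ->
    f x' <= f x + dot (gradient f x) (x' - x) + L / 2 * l1norm (x' - x) ^+ 2.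

End Geometry.

Arguments simplex {R} n.

Section Game.
Context {R : realType}.

(* 0 ln 0 = 0 holds because of the vanishing factor. *)
Definition negent {n : nat} (x : 'cV[R]_n) : R := \sum_i x i 0 * ln (x i 0).

Context {m n : nat}.
Variables (A : 'M[R]_(m, n)) (eta : R).

Definition logit_x (y : 'cV[R]_m) : 'cV[R]_n :=
  argmin (simplex n) (fun x : 'cV[R]_n => dot (A^T *m y) x + eta * negent x).

Definition logit_y (x : 'cV[R]_n) : 'cV[R]_m :=
  argmax (simplex m) (fun y : 'cV[R]_m => dot (A *m x) y - eta * negent y).

Definition fixed_point (x : 'cV[R]_n) (y : 'cV[R]_m) : Prop :=
  logit_x y = x /\ logit_y x = y.

Definition duality_gap (x : 'cV[R]_n) (y : 'cV[R]_m) : R :=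
  eta * ln (\sum_(j < m) expR ((A *m x) j 0 / eta)) + eta * negent x
  + eta * ln (\sum_(i < n) expR (- (A^T *m y) i 0 / eta)) + eta * negent y.

(* For eta > 0 the gap is continuous on the compact product of the simplices,
   so the supremum is attained. *)
Definition duality_gap_max : R :=
  sup [set duality_gap p.1 p.2 | p in simplex n `*` simplex m].

End Game.

Section Process.
Context {R : realType} {d : measure_display} {Omega : measurableType d}.
Variable P : probability Omega R.

(* g is a version of the conditional probability of E given the
   sub-sigma-algebra F. *)
Definition is_cond_prob (F : set (set Omega)) (E : set Omega)
    (g : Omega -> R) : Prop :=
  preimage_set_system setT g measurable `<=` F /\
  forall B, F B -> P (E `&` B) = (\int[P]_(w in B) (g w)%:E)%E.

Definition cond_expectation (X : Omega -> R) (E : set Omega) : \bar R :=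
  ((fine (P E))^-1%:E * \int[P]_(w in E) (X w)%:E)%E.

Context {m n : nat}.
Variables (x : nat -> Omega -> 'cV[R]_n) (y : nat -> Omega -> 'cV[R]_m).

(* sigma((x^k, y^k), k <= t), generated by the coordinates. *)
Definition history (t : nat) : set (set Omega) :=
  <<s \bigcup_(k in [set k | (k <= t)%N])
        ((\bigcup_(i in [set: 'I_n])
            preimage_set_system setT (fun w => x k w i 0) measurable) `|`
         (\bigcup_(j in [set: 'I_m])
            preimage_set_system setT (fun w => y k w j 0) measurable)) >>.

(* I t.+1 and J t.+1 are the actions sampled at step t.  Only the two
   conditional marginals given the history are prescribed: no conditional
   independence of I t.+1 and J t.+1 is required. *)
Record is_lfp (A : 'M[R]_(m, n)) (eta : R) (alpha : nat -> R)
    (i0 : 'I_n) (j0 : 'I_m)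
    (I : nat -> Omega -> 'I_n) (J : nat -> Omega -> 'I_m) : Prop := {
  lfp_step : forall t, 0 < alpha t <= 1;
  lfp_measI : forall t i, measurable (I t.+1 @^-1` [set i]);
  lfp_measJ : forall t j, measurable (J t.+1 @^-1` [set j]);
  lfp_x0 : forall w, x 0 w = stdvec i0;
  lfp_y0 : forall w, y 0 w = stdvec j0;
  lfp_xS : forall t w,
    x t.+1 w = (1 - alpha t) *: x t w + alpha t *: stdvec (I t.+1 w);
  lfp_yS : forall t w,
    y t.+1 w = (1 - alpha t) *: y t w + alpha t *: stdvec (J t.+1 w);
  lfp_condI : forall t i,
    is_cond_prob (history t) (I t.+1 @^-1` [set i])
      (fun w => logit_x A eta (y t w) i 0);
  lfp_condJ : forall t j,
    is_cond_prob (history t) (J t.+1 @^-1` [set j])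
      (fun w => logit_y A eta (x t w) j 0)
}.

Definition stay_event (N : set ('cV[R]_n * 'cV[R]_m)) (T : nat) : set Omega :=
  [set w | forall t, (T <= t)%N -> N (x t w, y t w)].

End Process.

(* Main.v *)
Require Import Defs.
From HB Require Import structures.
From mathcomp Require Import all_boot all_order all_algebra.
From mathcomp Require Import all_classical all_reals all_analysis.
From mathcomp Require Import ring lra.

Import Order.TTheory GRing.Theory Num.Theory.
Import numFieldNormedType.Exports.

(** Along one step of the algorithm the duality gap contracts by the factor
    1 - alpha_t, up to a martingale difference and a term quadratic in alpha_t:
    log-sum-exp is smooth by Hoeffding's lemma, the entropies are smooth inside
    the neighbourhood, and towards the logit responses the linearised gap
    decreases by the gap itself ([gap_step], [gap_logit_direction]).  With
    alpha_t = 2/(t+2), multiplication by t(t+1) telescopes the recursion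
    ([weighted_recursion]), and this produces the two terms of the bound.

    The delicate point is the conditioning on staying in the neighbourhood
    forever.  This event looks into the future, so the martingale differences
    do not average to zero on it.  They do on the event of having stayed so
    far, and the two events differ by an escape after time t
    ([Ex_noise_stay]).  The weighted sum of the errors is therefore bounded by
    a constant as soon as the probability of a late escape decays like t^-3.
    This constant is absorbed by the first term of the bound: T may be chosen
    large, and near the fixed point the gap at time T is well below its
    maximum, which leaves a margin of order T^2 ([exists_stay_time]).

    The decay of the escape probability also gives the first claim.  The
    entropy has infinite slope at the boundary, where the process starts, so
    the process is compared with a companion in which each sampled vertex is
    replaced by its conditional expectation.  The companion stays away from the
    boundary, where the gap is a smooth Lyapunov function, and it converges
    whenever the distance between the two processes is eventually small
    ([mean_tracking]); a small gap forces closeness to the fixed point because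
    the gap dominates a relative entropy ([gap_ge_kl]).  The distance itself is
    a weighted martingale average with exponentially small tails
    ([Ex_exp_martingale], [noise_tail]), which yields [escape_tail].

    All random variables involved take finitely many values at each time, so
    expectations are handled through variables that factor through a finite
    type. *)

Set Implicit Arguments.
Unset Strict Implicit.
Unset Printing Implicit Defensive.

Local Open Scope classical_set_scope.
Local Open Scope ring_scope.

(** * Moment generating functions of bounded variables *)

Section ExpInequalities.
Context {R : realType}.

Lemma is_derive_ge0_ge_at0 (f df : R -> R) (a : R) :
  (forall u, is_derive (u : R) (1 : R) f (df u)) ->
  (forall u, 0 <= u -> 0 <= df u) ->
  0 <= a -> f 0 <= f a.
Proof.
move=> fdf df0 a0.
have fc : {within `[0, a], continuous f}.
  apply: derivable_within_continuous => u _; exact: ex_derive.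
have [c] := MVT_segment a0 (fun u _ => fdf u) fc.
rewrite in_itv/= => /andP[c0 _] fE; rewrite -subr_ge0 fE subr0.
by rewrite mulr_ge0// df0.
Qed.

(** The sharp constant 1/2 is what makes the coefficient of kappa in the final
    bound come out right.  With c(u) = q e^u + r e^-u and E(u) the right-hand
    side, c'' = c while E'' >= E; so e^u (h' - h) and then e^-u h are
    nondecreasing for h = E - c, and h vanishes with h' at 0. *)
Lemma two_point_mgf (q r a : R) : q + r = 1 -> 0 <= a ->
  q * expR a + r * expR (- a) <= expR ((q - r) * a + a ^+ 2 / 2).
Proof.
move=> qr1 a0.
pose k1 (u : R) :=
  (q - r - 1 + u) * expR ((q - r + 1) * u + u ^+ 2 / 2) + 2 * r.
pose dk1 (u : R) := (q - r + u) ^+ 2 * expR ((q - r + 1) * u + u ^+ 2 / 2).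
(* k1 is e^u (h' - h), and k2 below is e^-u h *)
have k1_ge0 u : 0 <= u -> 0 <= k1 u.
  have k10 : k1 0 = 0.
    rewrite /k1 expr0n/= mul0r mulr0 !addr0 expR0 mulr1.
    by have -> : r = 1 - q; [rewrite -qr1; ring|ring].
  move=> u0; rewrite -k10.
  apply: (@is_derive_ge0_ge_at0 k1 dk1 u) => [v|v _|//]; last first.
    by rewrite mulr_ge0 ?sqr_ge0 ?expR_ge0.
  rewrite /k1 /dk1; apply: is_derive_eq.
  rewrite /GRing.scale/= !mulr1 ?add0r ?addr0 ?expr1 ?mulr0 ?addr0 ?mul0r ?addr0.
  by field.
pose k2 (u : R) :=
  expR ((q - r - 1) * u + u ^+ 2 / 2) - q - r * expR (- (2 * u)).
pose dk2 (u : R) := expR (- (2 * u)) * k1 u.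
have : k2 0 <= k2 a.
  apply: (@is_derive_ge0_ge_at0 k2 dk2 a) => [v|v v0|//]; last first.
    by rewrite mulr_ge0 ?expR_ge0 ?k1_ge0.
  rewrite /k2 /dk2 /k1; apply: is_derive_eq.
  rewrite /GRing.scale/=.
  have <- : expR (- (2 * v)) * expR ((q - r + 1) * v + v ^+ 2 / 2)
     = expR ((q - r - 1) * v + v ^+ 2 / 2).
    by rewrite -expRD; congr expR; ring.
  rewrite ?expr1 ?mulr1 ?mulr0 ?add0r ?addr0.
  by field.
have -> : k2 0 = 0.
  rewrite /k2 expr0n/= mul0r mulr0 addr0 mulr0 oppr0 expR0; lra.
rewrite /k2 subr_ge0 => h.
have := ler_wpM2l (expR_ge0 a) h.
rewrite mulrBr -expRD mulrCA -expRD => h1.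
have -> : (q - r) * a + a ^+ 2 / 2 = a + ((q - r - 1) * a + a ^+ 2 / 2) by ring.
have e : a + - (2 * a) = - a by ring.
by move: h1; rewrite e; lra.
Qed.

(** The weights average a and -a to d, so the tangent line of exp at d, taken
    at those two points, gives the chord bound. *)
Lemma expR_le_chord (a d : R) : 0 < a -> `|d| <= a ->
  expR d <= (a + d) / (2 * a) * expR a + (a - d) / (2 * a) * expR (- a).
Proof.
move=> a0; rewrite ler_norml => /andP[da ad].
have tan v : expR d * (1 + (v - d)) <= expR v.
  rewrite -[in leRHS](subrK d v) expRD mulrC.
  by rewrite ler_pM2r ?expR_gt0// expR_ge1Dx.
have q0 : 0 <= (a + d) / (2 * a) by rewrite divr_ge0; lra.
have r0 : 0 <= (a - d) / (2 * a) by rewrite divr_ge0; lra.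
have := lerD (ler_wpM2l q0 (tan a)) (ler_wpM2l r0 (tan (- a))).
apply: le_trans; rewrite le_eqVlt; apply/orP; left; apply/eqP.
field; lra.
Qed.

(** Hoeffding's lemma: bound exp by its chord on [-a, a], average, and what
    remains is the two-point case. *)
Lemma hoeffding_mgf n (p d : 'I_n -> R) (a : R) :
  (forall i, 0 <= p i) -> \sum_i p i = 1 -> (forall i, `|d i| <= a) ->
  \sum_i p i * expR (d i) <= expR (\sum_i p i * d i + a ^+ 2 / 2).
Proof.
move=> p0 p1 da.
have [i0 _|nocol] := pickP (fun i : 'I_n => true); last first.
  by move: p1; rewrite big_pred0 // => /eqP; rewrite eq_sym oner_eq0.
have a_ge0 : 0 <= a by rewrite (le_trans _ (da i0)).
have [a0|a0] := ltP 0 a; last first.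
  have aE : a = 0 by apply/eqP; rewrite eq_le a0 a_ge0.
  have dE i : d i = 0.
    by apply/eqP; rewrite -normr_le0 -aE.
  under eq_bigr do rewrite dE expR0 mulr1.
  under [in leRHS]eq_bigr do rewrite dE mulr0.
  by rewrite p1 big1// aE expr0n/= mul0r addr0 expR0.
set mu := \sum_i p i * d i.
apply: (@le_trans _ _ ((a + mu) / (2 * a) * expR a
                       + (a - mu) / (2 * a) * expR (- a))).
  have -> : (a + mu) / (2 * a) * expR a + (a - mu) / (2 * a) * expR (- a)
    = \sum_i p i * ((a + d i) / (2 * a) * expR a
                  + (a - d i) / (2 * a) * expR (- a)).
    transitivity (\sum_i (p i * (expR a / 2 + expR (- a) / 2)
       + p i * d i * (expR a / (2 * a) - expR (- a) / (2 * a)))).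
      rewrite big_split/= -!mulr_suml p1 -/mu; field; lra.
    by apply: eq_bigr => i _; field; lra.
  by apply: ler_sum => i _; rewrite ler_wpM2l// expR_le_chord.
apply: le_trans (two_point_mgf _ _) _ => //; first by field; lra.
rewrite ler_expR lerD2r le_eqVlt; apply/orP; left; apply/eqP.
by field; lra.
Qed.

End ExpInequalities.

(** * Softmax, log-sum-exp and relative entropy *)

Section Softmax.
Context {R : realType} {n : nat}.
Implicit Types (x y z p q d : 'cV[R]_n).

Definition lse z : R := ln (\sum_i expR (z i 0)).

Definition softmax z : 'cV[R]_n :=
  \col_i (expR (z i 0) / \sum_k expR (z k 0)).

Definition kl p q : R := \sum_i p i 0 * (ln (p i 0) - ln (q i 0)).

Lemma dotC x y : dot x y = dot y x.
Proof. by apply: eq_bigr => i _; rewrite mulrC. Qed.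

Lemma dotDr x y z : dot x (y + z) = dot x y + dot x z.
Proof. by rewrite -big_split/=; apply: eq_bigr => i _; rewrite mxE mulrDr. Qed.

Lemma dotZr (a : R) x y : dot x (a *: y) = a * dot x y.
Proof. by rewrite mulr_sumr; apply: eq_bigr => i _; rewrite mxE mulrCA. Qed.

Lemma dotNr x y : dot x (- y) = - dot x y.
Proof. by rewrite -scaleN1r dotZr mulN1r. Qed.

Lemma dotBr x y z : dot x (y - z) = dot x y - dot x z.
Proof. by rewrite dotDr dotNr. Qed.

Lemma dotDl x y z : dot (x + y) z = dot x z + dot y z.
Proof. by rewrite !(dotC _ z) dotDr. Qed.

Lemma dotZl (a : R) x y : dot (a *: x) y = a * dot x y.
Proof. by rewrite !(dotC _ y) dotZr. Qed.

Lemma dotNl x y : dot (- x) y = - dot x y.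
Proof. by rewrite !(dotC _ y) dotNr. Qed.

Lemma simplex_ge0 x i : simplex n x -> 0 <= x i 0.
Proof. by move=> [+ _]; apply. Qed.

Lemma simplex_le1 x i : simplex n x -> x i 0 <= 1.
Proof.
move=> [x0 <-]; rewrite (bigD1 i)//= lerDl; exact: sumr_ge0.
Qed.

Lemma simplex_convex (a : R) x y : 0 <= a <= 1 -> simplex n x -> simplex n y ->
  simplex n ((1 - a) *: x + a *: y).
Proof.
move=> /andP[a0 a1] [x0 x1] [y0 y1]; split=> [i|].
  by rewrite !mxE addr_ge0// mulr_ge0// subr_ge0.
under eq_bigr do rewrite !mxE.
by rewrite big_split/= -!mulr_sumr x1 y1 !mulr1 subrK.
Qed.

Lemma simplex_stdvec i : simplex n (@stdvec R n i).
Proof.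
split=> [k|]; first by rewrite mxE; case: eqP => //=; rewrite ?andbT ?ler0n.
rewrite (bigD1 i)//= big1 ?addr0 => [|k ki]; rewrite mxE ?eqxx//.
by rewrite (negbTE ki).
Qed.

Lemma l1norm_ge0 x : 0 <= l1norm x.
Proof. exact: sumr_ge0. Qed.

Lemma l1normZ (a : R) x : l1norm (a *: x) = `|a| * l1norm x.
Proof. by rewrite mulr_sumr; apply: eq_bigr => i _; rewrite mxE normrM. Qed.

Lemma l1norm_ge_coord x i : `|x i 0| <= l1norm x.
Proof. by rewrite /l1norm (bigD1 i)//= lerDl sumr_ge0. Qed.

Lemma l1norm_simplexB x y : simplex n x -> simplex n y -> l1norm (x - y) <= 2.
Proof.
move=> [x0 x1] [y0 y1].
apply: (@le_trans _ _ (\sum_i (x i 0 + y i 0))).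
  by apply: ler_sum => i _; rewrite !mxE (le_trans (ler_normB _ _))// !ger0_norm.
by rewrite big_split/= x1 y1.
Qed.

Lemma negent_le0 x : simplex n x -> negent x <= 0.
Proof.
move=> xs; apply: sumr_le0 => i _.
by rewrite mulr_ge0_le0 ?simplex_ge0// ln_le0// simplex_le1.
Qed.

Hypothesis n0 : (0 < n)%N.

Lemma sum_expR_gt0 z : 0 < \sum_i expR (z i 0).
Proof.
rewrite (bigD1 (Ordinal n0))//= ltr_wpDr ?expR_gt0//.
by apply: sumr_ge0 => i _; exact: expR_ge0.
Qed.

Lemma softmax_gt0 z i : 0 < softmax z i 0.
Proof. by rewrite mxE divr_gt0 ?expR_gt0 ?sum_expR_gt0. Qed.

Lemma softmax_simplex z : simplex n (softmax z).
Proof.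
split=> [i|]; first exact/ltW/softmax_gt0.
under eq_bigr do rewrite mxE.
by rewrite -mulr_suml divff// gt_eqF// sum_expR_gt0.
Qed.

Lemma ln_softmax z i : ln (softmax z i 0) = z i 0 - lse z.
Proof. by rewrite mxE ln_div ?expRK// posrE ?expR_gt0 ?sum_expR_gt0. Qed.

(** Gibbs variational principle: the slack in the dual formula for log-sum-exp
    is a relative entropy, which makes softmax the unique optimiser and later
    turns a small gap into closeness to the fixed point. *)
Lemma lse_gibbs z p : simplex n p ->
  lse z = dot z p - negent p + kl p (softmax z).
Proof.
move=> [_ p1]; rewrite /dot /negent /kl -sumrB -big_split/=.
rewrite -[LHS]mul1r -p1 mulr_suml; apply: eq_bigr => i _.
rewrite ln_softmax; ring.
Qed.

(** Relative entropy dominates the squared Hellinger distance, since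
    ln u <= u - 1 at u = sqrt (q/p); and p - q is the
    difference of the square roots times their sum, which is at most 2. *)
Lemma kl_ge_sqr_coord p q i : simplex n p -> simplex n q ->
  (forall k, 0 < q k 0) -> (p i 0 - q i 0) ^+ 2 <= 4 * kl p q.
Proof.
move=> ps qs q0.
have p0 k : 0 <= p k 0 by exact: simplex_ge0.
have hell k : (Num.sqrt (p k 0) - Num.sqrt (q k 0)) ^+ 2 <=
    p k 0 * (ln (p k 0) - ln (q k 0)) - p k 0 + q k 0.
  have := p0 k; rewrite le_eqVlt => /predU1P[<-|pk].
    by rewrite sqrtr0 !mul0r sub0r sqrrN subr0 add0r sqr_sqrtr// ltW.
  set a := Num.sqrt (p k 0); set b := Num.sqrt (q k 0).
  have a0 : 0 < a by rewrite sqrtr_gt0.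
  have b0 : 0 < b by rewrite sqrtr_gt0.
  have -> : p k 0 = a ^+ 2 by rewrite sqr_sqrtr.
  have -> : q k 0 = b ^+ 2 by rewrite sqr_sqrtr// ltW.
  rewrite !lnXn// -mulrnBl.
  have := @le_ln1Dx R (b / a - 1).
  rewrite (addrC 1) subrK ln_div ?posrE// ltrBrDr addNr divr_gt0// => /(_ isT) h.
  have : a ^+ 2 * (ln b - ln a) <= a ^+ 2 * (b / a - 1).
    by rewrite ler_wpM2l// sqr_ge0.
  have -> : a ^+ 2 * (b / a - 1) = a * b - a ^+ 2 by field; rewrite gt_eqF.
  rewrite mulr2n; lra.
have : (Num.sqrt (p i 0) - Num.sqrt (q i 0)) ^+ 2 <= kl p q.
  apply: (@le_trans _ _ (\sum_k (Num.sqrt (p k 0) - Num.sqrt (q k 0)) ^+ 2)).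
    by rewrite (bigD1 i)//= lerDl sumr_ge0// => k _; exact: sqr_ge0.
  have -> : kl p q = \sum_k (p k 0 * (ln (p k 0) - ln (q k 0)) - p k 0 + q k 0).
    rewrite big_split sumrB/=; case: ps => _ ->; case: qs => _ ->.
    by rewrite subrK.
  exact: ler_sum.
move=> h; apply: le_trans (_ : 4 * (Num.sqrt (p i 0) - Num.sqrt (q i 0)) ^+ 2 <= _).
  set a := Num.sqrt (p i 0); set b := Num.sqrt (q i 0).
  have pE : p i 0 = a ^+ 2 by rewrite sqr_sqrtr.
  have qE : q i 0 = b ^+ 2 by rewrite sqr_sqrtr// ltW.
  have a0 : 0 <= a by exact: sqrtr_ge0.
  have b0 : 0 <= b by exact: sqrtr_ge0.
  have a1 : a <= 1 by rewrite -(expr_le1 (n:=2))// -pE simplex_le1.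
  have b1 : b <= 1 by rewrite -(expr_le1 (n:=2))// -qE simplex_le1.
  rewrite pE qE subr_sqr exprMn mulrC ler_wpM2r ?sqr_ge0//.
  have -> : 4 = 2 ^+ 2 :> R by ring.
  by rewrite lerXn2r ?nnegrE; lra.
by rewrite ler_wpM2l.
Qed.

Lemma kl_ge0 p q : simplex n p -> simplex n q ->
  (forall k, 0 < q k 0) -> 0 <= kl p q.
Proof.
move=> ps qs q0; rewrite -(pmulr_rge0 _ (ltr0n R 4)).
exact: le_trans (sqr_ge0 _) (kl_ge_sqr_coord (Ordinal n0) ps qs q0).
Qed.

Lemma kl_eq0 p q : simplex n p -> simplex n q ->
  (forall k, 0 < q k 0) -> kl p q <= 0 -> p = q.
Proof.
move=> ps qs q0 kl0; apply/matrixP => i j; rewrite ord1; apply/eqP.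
rewrite -subr_eq0 -sqrf_eq0 eq_le sqr_ge0 andbT.
by rewrite (le_trans (kl_ge_sqr_coord i ps qs q0))// pmulr_rle0.
Qed.

Lemma lse_dual_le z p : simplex n p -> dot z p - negent p <= lse z.
Proof.
move=> ps; rewrite (lse_gibbs z ps) lerDl kl_ge0//; first exact: softmax_simplex.
exact: softmax_gt0.
Qed.

Lemma klxx p : kl p p = 0.
Proof. by apply: big1 => i _; rewrite subrr mulr0. Qed.

Lemma lse_dual_eq z : dot z (softmax z) - negent (softmax z) = lse z.
Proof. by rewrite (lse_gibbs z (softmax_simplex z)) klxx addr0. Qed.

(** The hypothesis is the shape that the logit objectives take after
    [lse_gibbs]: a relative entropy to softmax plus a constant. *)
Lemma argmin_softmax (f : 'cV[R]_n -> R) (eta : R) z : 0 < eta ->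
  (forall x, simplex n x -> f x = eta * (kl x (softmax z) - lse z)) ->
  argmin (simplex n) f = softmax z.
Proof.
move=> eta0 fE; rewrite /argmin.
set S := [set x | _].
have ss := softmax_simplex z.
have Sz : S (softmax z).
  split=> // x xs; rewrite !fE// klxx ler_pM2l// lerB// kl_ge0//.
  exact: softmax_gt0.
have [gs gmin] : S (get S) by apply: getPex; exists (softmax z).
have := gmin _ ss; rewrite !fE// klxx ler_pM2l// lerD2r.
by apply: kl_eq0 => //; exact: softmax_gt0.
Qed.

(** Log-sum-exp is 1-smooth for the sup norm: its increment is the logarithm of
    a moment generating function under the softmax law. *)
Lemma lse_descent z d (a : R) : (forall i, `|d i 0| <= a) ->
  lse (z + d) <= lse z + dot (softmax z) d + a ^+ 2 / 2.
Proof.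
move=> da; have Z0 := sum_expR_gt0 z.
have S0 : 0 < \sum_i softmax z i 0 * expR (d i 0).
  rewrite (bigD1 (Ordinal n0))//= ltr_wpDr ?mulr_gt0 ?expR_gt0 ?softmax_gt0//.
  by apply: sumr_ge0 => i _; rewrite mulr_ge0 ?expR_ge0 ?ltW ?softmax_gt0.
have h : \sum_i softmax z i 0 * expR (d i 0)
    <= expR (dot (softmax z) d + a ^+ 2 / 2).
  exact: hoeffding_mgf (fun i => ltW (softmax_gt0 z i))
    (proj2 (softmax_simplex z)) da.
move: h; rewrite -[_ <= expR _]ler_ln ?posrE ?expR_gt0//.
rewrite expRK => h; rewrite -addrA -lerBlDl; apply: le_trans h.
rewrite /lse -ln_div ?posrE ?sum_expR_gt0// mulr_suml.
rewrite le_eqVlt; apply/orP; left; apply/eqP; congr ln.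
by apply: eq_bigr => i _; rewrite !mxE expRD; field; rewrite gt_eqF.
Qed.

(** Numerator and normaliser each move by a factor between e^-a and e^a. *)
Lemma softmax_perturb z d (a : R) i : (forall k, `|d k 0| <= a) ->
  `|softmax (z + d) i 0 - softmax z i 0| <= (expR (2 * a) - 1) * softmax z i 0.
Proof.
move=> da.
have da' k : - a <= d k 0 <= a by rewrite -ler_norml.
have a0 : 0 <= a by exact: le_trans (da i).
have Z0 := sum_expR_gt0 z; have Z'0 := sum_expR_gt0 (z + d).
set Z := \sum_i _ in Z0; set Z' := \sum_i _ in Z'0.
have Zu : Z' <= expR a * Z.
  rewrite mulr_sumr; apply: ler_sum => k _; rewrite !mxE expRD mulrC.
  by rewrite ler_wpM2r ?expR_ge0// ler_expR; case/andP: (da' k).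
have Zl : expR (- a) * Z <= Z'.
  rewrite mulr_sumr; apply: ler_sum => k _; rewrite !mxE expRD mulrC.
  by rewrite ler_wpM2l ?expR_ge0// ler_expR; case/andP: (da' k).
have p0 := softmax_gt0 z i.
have up : softmax (z + d) i 0 <= expR (2 * a) * softmax z i 0.
  rewrite !mxE -/Z -/Z' ler_pdivrMr// expRD.
  apply: (@le_trans _ _ (expR (2 * a) * (expR (z i 0) / Z) * (expR (- a) * Z))).
    have -> : expR (2 * a) * (expR (z i 0) / Z) * (expR (- a) * Z)
      = expR (z i 0) * (expR (2 * a) * expR (- a)) by field; rewrite gt_eqF.
    rewrite -(expRD (2 * a)) ler_wpM2l ?expR_ge0// ler_expR.
    by have := da' i; lra.
  by rewrite ler_wpM2l// !mulr_ge0 ?expR_ge0 ?invr_ge0 ?ltW.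
have lo : expR (- (2 * a)) * softmax z i 0 <= softmax (z + d) i 0.
  rewrite !mxE -/Z -/Z' ler_pdivlMr// expRD.
  apply: (@le_trans _ _ (expR (- (2 * a)) * (expR (z i 0) / Z) * (expR a * Z))).
    by rewrite ler_wpM2l// !mulr_ge0 ?expR_ge0 ?invr_ge0 ?ltW.
  have -> : expR (- (2 * a)) * (expR (z i 0) / Z) * (expR a * Z)
      = expR (z i 0) * (expR (- (2 * a)) * expR a) by field; rewrite gt_eqF.
  rewrite -(expRD (- (2 * a))) ler_wpM2l ?expR_ge0// ler_expR.
  by have := da' i; lra.
have e1 := expR_ge1Dx (2 * a); have e2 := expR_ge1Dx (- (2 * a)).
have e3 : 2 <= expR (2 * a) + expR (- (2 * a)) by lra.
have := ler_wpM2r (ltW p0) e3.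
rewrite ler_norml mulrBl mul1r mulrDl => ?; lra.
Qed.

Lemma softmax_lb z (b : R) i : (forall k, `|z k 0| <= b) ->
  expR (- (2 * b)) / n%:R <= softmax z i 0.
Proof.
move=> zb; have zb' k : - b <= z k 0 <= b by rewrite -ler_norml.
have nR : 0 < n%:R :> R by rewrite ltr0n.
have Z0 := sum_expR_gt0 z.
rewrite mxE ler_pdivrMr// mulrAC ler_pdivlMr//.
apply: (@le_trans _ _ (expR (- (2 * b)) * (n%:R * expR b))).
  rewrite ler_wpM2l ?expR_ge0//.
  apply: (@le_trans _ _ (\sum_(k < n) expR b)).
    by apply: ler_sum => k _; rewrite ler_expR; case/andP: (zb' k).
  by rewrite sumr_const card_ord mulr_natl.
rewrite mulrCA -expRD mulrC ler_wpM2r//; last by rewrite ler_expR; have := zb' i; lra.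
Qed.

Lemma lse_le z (b : R) : (forall k, z k 0 <= b) -> lse z <= b + ln n%:R.
Proof.
move=> zb; have nR : 0 < n%:R :> R by rewrite ltr0n.
rewrite -[b in leRHS]expRK -lnM ?posrE ?expR_gt0// /lse.
rewrite ler_ln ?posrE ?sum_expR_gt0 ?mulr_gt0 ?expR_gt0//.
apply: (@le_trans _ _ (\sum_(k < n) expR b)).
  by apply: ler_sum => k _; rewrite ler_expR.
by rewrite sumr_const card_ord mulr_natr.
Qed.

End Softmax.

(** * Gradient and curvature of the negative entropy *)

Section Entropy.
Context {R : realType} {n : nat}.
Implicit Types (x y : 'cV[R]_n).

Definition dnegent x : 'cV[R]_n := \col_i (ln (x i 0) + 1).

Lemma gradient_negent x : (forall i, 0 < x i 0) -> gradient negent x = dnegent x.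
Proof.
move=> x0; apply/matrixP => i j; rewrite ord1 !mxE.
pose phi (u : R) := u * ln u.
(* only the i-th summand moves along stdvec i *)
have -> : 'D_(stdvec i) negent x = 'D_1 phi (x i 0).
  suff E (h : R) : (negent \o shift x) (h *: stdvec i) - negent x
      = (phi \o shift (x i 0)) (h *: 1) - phi (x i 0).
    rewrite /derive; apply: (congr1 (fun g : R -> R => lim (g h @[h --> 0^']))).
    by apply/funext => h; rewrite E.
  rewrite /negent -sumrB (bigD1 i)//= big1 ?addr0 => [|k ki]; last first.
    by rewrite !mxE (negbTE ki) mulr0 add0r subrr.
  by rewrite !mxE eqxx /phi.
have xi := x0 i.
have dl : is_derive (x i 0) 1 (@ln R) (x i 0)^-1 by exact: is_derive1_ln.
rewrite /phi; rewrite derive_val /GRing.scale/= mulr1 divff ?gt_eqF//.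
by rewrite addrC.
Qed.

(** The entropy has unbounded curvature at the boundary; away from it,
    ln u <= u - 1 gives an upper quadratic model with an explicit constant. *)
Lemma negent_quad_ub x x' (e : R) : 0 < e -> (forall i, e <= x i 0) ->
  (forall i, 0 <= x' i 0) ->
  negent x' <= negent x + dot (dnegent x) (x' - x)
               + (2 / e) / 2 * l1norm (x' - x) ^+ 2.
Proof.
move=> e0 xe x'0.
have term i : x' i 0 * ln (x' i 0) <= x i 0 * ln (x i 0)
   + (ln (x i 0) + 1) * (x' i 0 - x i 0) + e^-1 * `|x' i 0 - x i 0| ^+ 2.
  have xi : 0 < x i 0 by apply: lt_le_trans (xe i).
  have qb : (x' i 0 - x i 0) ^+ 2 / x i 0 <= e^-1 * (x' i 0 - x i 0) ^+ 2.
    by rewrite mulrC ler_wpM2r ?sqr_ge0// lef_pV2.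
  rewrite real_normK ?num_real//; apply: le_trans (lerD (lexx _) qb).
  have := x'0 i; rewrite le_eqVlt => /predU1P[<-|x'i].
    rewrite mul0r sub0r sqrrN le_eqVlt; apply/orP; left; apply/eqP.
    by field; rewrite gt_eqF.
  have := @le_ln1Dx R (x' i 0 / x i 0 - 1).
  rewrite (addrC 1) subrK ln_div ?posrE// ltrBrDr addNr divr_gt0// => /(_ isT) h.
  have := ler_wpM2l (x'0 i) h.
  have -> : x' i 0 * (x' i 0 / x i 0 - 1)
     = (x' i 0 - x i 0) + (x' i 0 - x i 0) ^+ 2 / x i 0.
    by field; rewrite gt_eqF.
  lra.
have -> : 2 / e / 2 = e^-1 by field; rewrite gt_eqF.
apply: (@le_trans _ _ (\sum_i (x i 0 * ln (x i 0)
   + (ln (x i 0) + 1) * (x' i 0 - x i 0) + e^-1 * `|x' i 0 - x i 0| ^+ 2))).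
  exact: ler_sum.
rewrite !big_split/= -mulr_sumr.
apply: lerD; first by rewrite lerD2l ler_sum// => i _; rewrite !mxE.
rewrite ler_wpM2l ?invr_ge0 ?(ltW e0)//.
rewrite [leRHS]expr2 /l1norm mulr_suml; apply: ler_sum => i _.
rewrite expr2 !mxE ler_wpM2l//.
have := l1norm_ge_coord (x' - x) i; by rewrite /l1norm !mxE.
Qed.

End Entropy.

(** * The duality gap along one step *)

Section Gap.
Context {R : realType} {m n : nat}.
Variables (A : 'M[R]_(m, n)) (eta : R).
Hypotheses (eta0 : 0 < eta) (n0 : (0 < n)%N) (m0 : (0 < m)%N).
Implicit Types (x p : 'cV[R]_n) (y q : 'cV[R]_m).

Local Notation zx y := (- (eta^-1 *: (A^T *m y))).
Local Notation zy x := (eta^-1 *: (A *m x)).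
Local Notation gap := (duality_gap A eta).

Lemma dot_mulmx x y : dot (A *m x) y = dot (A^T *m y) x.
Proof.
rewrite /dot; under eq_bigr do rewrite mxE mulr_suml.
rewrite exchange_big/=; apply: eq_bigr => i _; rewrite mxE mulr_suml.
by apply: eq_bigr => j _; rewrite mxE mulrAC.
Qed.

Lemma norm_1oo_entry (j : 'I_m) (i : 'I_n) : `|A j i| <= norm_1oo A.
Proof.
apply: (@le_trans _ _ `|A *m stdvec i|).
  have -> : A j i = (A *m stdvec i) j 0.
    by rewrite mxE (bigD1 i)//= big1 ?addr0 => [|k ki];
      rewrite mxE ?eqxx ?mulr1// (negbTE ki) mulr0.
  rewrite /Num.norm/= mx_normrE.
  exact: (le_bigmax 0 (fun ij : 'I_m * 'I_1 => `|(A *m stdvec i) ij.1 ij.2|) (j, 0)).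
apply: ub_le_sup; last first.
  exists (stdvec i) => //=; rewrite /l1norm (bigD1 i)//= big1 ?addr0 => [|k ki].
    by rewrite mxE !eqxx normr1.
  by rewrite mxE (negbTE ki) normr0.
exists (\sum_j0 \sum_i0 `|A j0 i0|) => _ [z /= z1 <-].
rewrite /Num.norm/= mx_normrE; apply: bigmax_le => [|[k l] _ /=].
  by apply: sumr_ge0 => j1 _; apply: sumr_ge0 => i1 _; exact: normr_ge0.
rewrite (bigD1 k)//= -[leLHS]addr0 lerD//; last first.
  by apply: sumr_ge0 => j1 _; apply: sumr_ge0 => i1 _; exact: normr_ge0.
rewrite mxE; apply: (le_trans (ler_norm_sum _ _ _)).
apply: ler_sum => i1 _; rewrite normrM ler_piMr// (ord1 l) -z1.
exact: l1norm_ge_coord.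
Qed.

Lemma norm_1oo_ge0 : 0 <= norm_1oo A.
Proof. exact: le_trans (norm_1oo_entry (Ordinal m0) (Ordinal n0)). Qed.

Lemma mulmx_bound x j : `|(A *m x) j 0| <= norm_1oo A * l1norm x.
Proof.
rewrite mxE (le_trans (ler_norm_sum _ _ _))// mulr_sumr; apply: ler_sum => i _.
by rewrite normrM ler_wpM2r// norm_1oo_entry.
Qed.

Lemma trmulmx_bound y i : `|(A^T *m y) i 0| <= norm_1oo A * l1norm y.
Proof.
rewrite mxE (le_trans (ler_norm_sum _ _ _))// mulr_sumr; apply: ler_sum => j _.
by rewrite normrM ler_wpM2r// mxE norm_1oo_entry.
Qed.

Lemma gapE x y :
  gap x y = eta * (lse (zy x) + negent x + (lse (zx y) + negent y)).
Proof.
rewrite /duality_gap /lse.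
have -> : \sum_j expR ((A *m x) j 0 / eta) = \sum_j expR ((zy x) j 0).
  by apply: eq_bigr => j _; rewrite [in RHS]mxE mulrC.
have -> : \sum_i expR (- (A^T *m y) i 0 / eta) = \sum_i expR ((zx y) i 0).
  by apply: eq_bigr => i _; rewrite [in RHS]mxE [in RHS]mxE mulNr mulrC.
ring.
Qed.

Lemma logit_xE y : logit_x A eta y = softmax (zx y).
Proof.
apply: (argmin_softmax n0 eta0) => x xs.
rewrite (lse_gibbs n0 (zx y) xs) dotNl dotZl; by field; rewrite gt_eqF.
Qed.

Lemma logit_yE x : logit_y A eta x = softmax (zy x).
Proof.
rewrite /logit_y /argmax.
have -> : [set y | simplex m y /\ (forall y' : 'cV_m, simplex m y' ->
    dot (A *m x) y' - eta * negent y' <= dot (A *m x) y - eta * negent y)]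
  = [set y | simplex m y /\ (forall y' : 'cV_m, simplex m y' ->
    - (dot (A *m x) y - eta * negent y) <= - (dot (A *m x) y' - eta * negent y'))].
  by apply/seteqP; split => y /= [ys h]; split => // y' /h; rewrite lerN2.
apply: (argmin_softmax m0 eta0) => y ys.
rewrite (lse_gibbs m0 (zy x) ys) dotZl; by field; rewrite gt_eqF.
Qed.

Local Notation kappa := (norm_1oo A ^+ 2 / eta ^+ 2).

(** Partial gradients of the gap, written with the logit responses because
    softmax is the gradient of log-sum-exp. *)
Definition gap_grad_x x : 'cV[R]_n :=
  eta^-1 *: (A^T *m logit_y A eta x) + dnegent x.
Definition gap_grad_y y : 'cV[R]_m :=
  - (eta^-1 *: (A *m logit_x A eta y)) + dnegent y.

(** Quadratic upper model of the gap: log-sum-exp contributes kappa, the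
    entropies contribute whatever smoothness constants are available at the
    pair of points considered. *)
Lemma gap_descent x x' y y' (Lx Ly : R) :
  negent x' <= negent x + dot (dnegent x) (x' - x) + Lx / 2 * l1norm (x' - x) ^+ 2 ->
  negent y' <= negent y + dot (dnegent y) (y' - y) + Ly / 2 * l1norm (y' - y) ^+ 2 ->
  gap x' y' <= gap x y
    + eta * (dot (gap_grad_x x) (x' - x) + dot (gap_grad_y y) (y' - y))
    + eta / 2 * ((Lx + kappa) * l1norm (x' - x) ^+ 2
                 + (Ly + kappa) * l1norm (y' - y) ^+ 2).
Proof.
move=> hx hy.
pose dx := zy (x' - x); pose dy := zx (y' - y).
have lx : lse (zy x') <= lse (zy x) + dot (softmax (zy x)) dx
    + (eta^-1 * (norm_1oo A * l1norm (x' - x))) ^+ 2 / 2.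
  have -> : zy x' = zy x + dx by rewrite /dx -scalerDr -mulmxDr subrKC.
  apply: lse_descent => // j; rewrite mxE normrM gtr0_norm ?invr_gt0//.
  by rewrite ler_wpM2l ?invr_ge0 ?(ltW eta0)// mulmx_bound.
have ly : lse (zx y') <= lse (zx y) + dot (softmax (zx y)) dy
    + (eta^-1 * (norm_1oo A * l1norm (y' - y))) ^+ 2 / 2.
  have -> : zx y' = zx y + dy.
    by rewrite /dy -opprD -scalerDr -mulmxDr subrKC.
  apply: lse_descent => // j; rewrite mxE normrN mxE normrM gtr0_norm ?invr_gt0//.
  by rewrite ler_wpM2l ?invr_ge0 ?(ltW eta0)// trmulmx_bound.
have ex : dot (softmax (zy x)) dx
    = dot (eta^-1 *: (A^T *m logit_y A eta x)) (x' - x).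
  by rewrite logit_yE /dx dotZr dotC dot_mulmx dotZl.
have ey : dot (softmax (zx y)) dy
    = dot (- (eta^-1 *: (A *m logit_x A eta y))) (y' - y).
  rewrite logit_xE /dy dotNr dotNl dotZr dotZl.
  by rewrite (dotC _ (A^T *m _)) -dot_mulmx.
rewrite !gapE /gap_grad_x /gap_grad_y !(dotDl _ (dnegent _)) -ex -ey.
have := ler_wpM2l (ltW eta0) (lerD (lerD lx hx) (lerD ly hy)).
move/le_trans; apply.
rewrite le_eqVlt; apply/orP; left; apply/eqP; by field; rewrite gt_eqF.
Qed.

Lemma dot_sub_const (u : 'cV[R]_n) (c : R) x x' :
  \sum_i x i 0 = \sum_i x' i 0 -> (forall i, u i 0 = c) -> dot u (x' - x) = 0.
Proof.
move=> e uc; rewrite /dot; under eq_bigr do rewrite uc !mxE.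
by rewrite -mulr_sumr sumrB e subrr mulr0.
Qed.

(** Why the gap is a Lyapunov function: moving towards the logit responses,
    convexity of the entropies bounds the linearised change, the bilinear terms
    of the two players cancel, and what is left is minus the gap. *)
Lemma gap_logit_direction x y : simplex n x -> simplex m y ->
  (forall i, 0 < x i 0) -> (forall j, 0 < y j 0) ->
  eta * (dot (gap_grad_x x) (logit_x A eta y - x)
         + dot (gap_grad_y y) (logit_y A eta x - y)) <= - gap x y.
Proof.
move=> xs ys x0 y0.
have conv k (k0 : (0 < k)%N) (u v : 'cV[R]_k) : simplex k u -> simplex k v ->
    (forall i, 0 < u i 0) -> dot (dnegent u) (v - u) <= negent v - negent u.
  move=> us vs u0; have klge := kl_ge0 k0 vs us u0.
  have mass : \sum_i (v i 0 - u i 0) = 0.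
    by rewrite sumrB (proj2 us) (proj2 vs) subrr.
  have -> : dot (dnegent u) (v - u) = negent v - negent u - kl v u.
    rewrite -[RHS]addr0 -mass /dot /negent /kl -!sumrB -big_split/=.
    by apply: eq_bigr => i _; rewrite !mxE; ring.
  by rewrite lerBlDr lerDl.
have sx := softmax_simplex n0 (zx y); have sy := softmax_simplex m0 (zy x).
have cx := conv _ n0 _ _ xs sx x0; have cy := conv _ m0 _ _ ys sy y0.
have dx := lse_dual_eq n0 (zx y); have dy := lse_dual_eq m0 (zy x).
rewrite /gap_grad_x /gap_grad_y !(dotDl _ (dnegent _)) logit_xE logit_yE.
rewrite gapE -mulrN ler_pM2l//.
move: cx cy dx dy; set w := softmax _; set s := softmax _ => cx cy dx dy.
have e1 : dot (eta^-1 *: (A^T *m s)) (w - x)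
   = dot (zy w) s - dot (zy x) s.
  by rewrite !dotZl dotBr -!dot_mulmx mulrBr.
have e2 : dot (- (eta^-1 *: (A *m w))) (s - y)
   = - dot (zy w) s - dot (zx y) w.
  rewrite !dotNl !dotZl dotBr dot_mulmx (dot_mulmx w y); ring.
rewrite e1 e2 -dx -dy; lra.
Qed.

(** One step towards arbitrary points p and q.  Taking p and q to be sampled
    vertices gives the recursion of the algorithm, with a martingale
    difference as linear term; taking them to be logit responses gives the
    recursion of the mean process. *)
Lemma gap_step x p y q (al Lx Ly : R) :
  0 <= al <= 1 -> 0 <= Lx -> 0 <= Ly ->
  simplex n x -> simplex n p -> simplex m y -> simplex m q ->
  (forall i, 0 < x i 0) -> (forall j, 0 < y j 0) ->
  let x' := (1 - al) *: x + al *: p in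
  let y' := (1 - al) *: y + al *: q in
  negent x' <= negent x + dot (dnegent x) (x' - x) + Lx / 2 * l1norm (x' - x) ^+ 2 ->
  negent y' <= negent y + dot (dnegent y) (y' - y) + Ly / 2 * l1norm (y' - y) ^+ 2 ->
  gap x' y' <= (1 - al) * gap x y
    + al * (eta * (dot (gap_grad_x x) (p - logit_x A eta y)
            + dot (gap_grad_y y) (q - logit_y A eta x)))
    + 2 * eta * (Lx + Ly + 2 * kappa) * al ^+ 2.
Proof.
move=> /andP[al0 al1] Lx0 Ly0 xs ps ys qs x0 y0 x' y' hx hy.
have ex : x' - x = al *: (p - x).
  by apply/matrixP=> i j; rewrite !mxE; ring.
have ey : y' - y = al *: (q - y).
  by apply/matrixP=> i j; rewrite !mxE; ring.
have := gap_descent hx hy; move/le_trans; apply.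
rewrite ex ey !l1normZ !dotZr (ger0_norm al0).
have kap0 : 0 <= kappa by rewrite divr_ge0 ?sqr_ge0.
have sq k (u v : 'cV[R]_k) : simplex k u -> simplex k v ->
    (al * l1norm (u - v)) ^+ 2 <= 4 * al ^+ 2.
  move=> us vs; rewrite exprMn mulrC ler_wpM2r ?sqr_ge0//.
  have -> : 4 = 2 ^+ 2 :> R by ring.
  by rewrite lerXn2r ?nnegrE ?l1norm_ge0 ?l1norm_simplexB//.
have q1 := ler_wpM2l (addr_ge0 Lx0 kap0) (sq _ _ _ ps xs).
have q2 := ler_wpM2l (addr_ge0 Ly0 kap0) (sq _ _ _ qs ys).
have e2 : 0 <= eta / 2 by rewrite divr_ge0 ?(ltW eta0).
have q3 := ler_wpM2l e2 (lerD q1 q2).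
have dir := ler_wpM2l al0 (gap_logit_direction xs ys x0 y0).
move: q3 dir; rewrite !dotBr.
set a := dot _ p; set b := dot _ x; set c := dot _ (logit_x _ _ _).
set a' := dot _ q; set b' := dot _ y; set c' := dot _ (logit_y _ _ _).
move=> q3 dir.
lra.
Qed.

End Gap.

(** * Step sizes 2/(t+2) *)

Section Recursion.
Context {R : realType}.

(** Multiplying by (t+1)(t+2) telescopes, as (1 - 2/(t+2)) (t+1)(t+2) is
    t(t+1). *)
Lemma weighted_recursion (D e : nat -> R) (C : R) (tau t : nat) : 0 <= C ->
  (tau <= t)%N ->
  (forall s, (tau <= s < t)%N -> D s.+1 <= (1 - 2 / (s%:R + 2)) * D s
     + 2 / (s%:R + 2) * e s + C * (2 / (s%:R + 2)) ^+ 2) ->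
  t%:R * (t%:R + 1) * D t <= tau%:R * (tau%:R + 1) * D tau
     + \sum_(tau <= s < t) 2 * (s%:R + 1) * e s + 4 * C * (t%:R - tau%:R).
Proof.
move=> C0; elim: t => [|t IH].
  by rewrite leqn0 => /eqP -> _; rewrite big_geq// subrr mulr0 !addr0.
rewrite leq_eqVlt => /predU1P[<- _|].
  by rewrite big_geq// subrr mulr0 !addr0.
rewrite ltnS => taut step.
have {}IH := IH taut (fun s st => step s
  ltac:(case/andP: st => -> /ltnW; rewrite ltnS => ->; done)).
rewrite big_nat_recr//=.
have t0 : 0 <= t%:R :> R by rewrite ler0n.
have := step t; rewrite taut ltnSn => /(_ isT).
have w0 : 0 <= t.+1%:R * (t.+1%:R + 1) :> R by rewrite mulr_ge0 ?addr_ge0.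
move=> /(ler_wpM2l w0).
have -> : t.+1%:R * (t.+1%:R + 1) * ((1 - 2 / (t%:R + 2)) * D t
     + 2 / (t%:R + 2) * e t + C * (2 / (t%:R + 2)) ^+ 2)
  = t%:R * (t%:R + 1) * D t + 2 * (t%:R + 1) * e t
    + 4 * C * ((t%:R + 1) / (t%:R + 2)) :> R.
  by rewrite -[t.+1%:R]natr1; field; lra.
have q1 : (t%:R + 1) / (t%:R + 2) <= 1 :> R by rewrite ler_pdivrMr; lra.
have := ler_wpM2l (mulr_ge0 (ler0n R 4) C0) q1.
rewrite -[t.+1%:R]natr1; lra.
Qed.

End Recursion.

(** * Size of the gap and stability of the logit responses *)

Section GapBounds.
Context {R : realType} {m n : nat}.
Variables (A : 'M[R]_(m, n)) (eta : R).
Hypotheses (eta0 : 0 < eta) (n0 : (0 < n)%N) (m0 : (0 < m)%N).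
Implicit Types (x p : 'cV[R]_n) (y q : 'cV[R]_m).

Local Notation zx y := (- (eta^-1 *: (A^T *m y))).
Local Notation zy x := (eta^-1 *: (A *m x)).
Local Notation gap := (duality_gap A eta).
Local Notation gmax := (duality_gap_max A eta).

Lemma l1norm_simplex k (x : 'cV[R]_k) : simplex k x -> l1norm x = 1.
Proof.
by move=> [x0 <-]; apply: eq_bigr => i _; rewrite ger0_norm.
Qed.

Definition payoff_bound : R := eta^-1 * norm_1oo A.

Lemma payoff_bound_ge0 : 0 <= payoff_bound.
Proof. by rewrite mulr_ge0 ?invr_ge0 ?(ltW eta0)// norm_1oo_ge0. Qed.

Lemma zx_bound y i : `|(zx y) i 0| <= payoff_bound * l1norm y.
Proof.
rewrite mxE normrN mxE normrM gtr0_norm ?invr_gt0// -mulrA.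
by rewrite ler_wpM2l ?invr_ge0 ?(ltW eta0)// trmulmx_bound.
Qed.

Lemma zy_bound x j : `|(zy x) j 0| <= payoff_bound * l1norm x.
Proof.
rewrite mxE normrM gtr0_norm ?invr_gt0// -mulrA.
by rewrite ler_wpM2l ?invr_ge0 ?(ltW eta0)// mulmx_bound.
Qed.

Lemma gap_le_max x y : simplex n x -> simplex m y -> gap x y <= gmax.
Proof.
move=> xs ys; apply: ub_le_sup; last by exists (x, y).
exists (eta * (payoff_bound + ln m%:R + (payoff_bound + ln n%:R))).
move=> _ [[x' y'] /= [xs' ys'] <-].
rewrite gapE// ler_pM2l//.
have ly : lse (zy x') <= payoff_bound + ln m%:R.
  apply: lse_le => // j; apply: le_trans (ler_norm _) _.
  by apply: le_trans (zy_bound _ _) _; rewrite l1norm_simplex// mulr1.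
have lx : lse (zx y') <= payoff_bound + ln n%:R.
  apply: lse_le => // i; apply: le_trans (ler_norm _) _.
  by apply: le_trans (zx_bound _ _) _; rewrite l1norm_simplex// mulr1.
have := negent_le0 xs'; have := negent_le0 ys'; lra.
Qed.

(** Insert the fixed point as a competitor in both dual formulas; the Gibbs
    identities at the fixed point turn the remainder into relative entropies. *)
Lemma gap_ge_kl x y xs ys : fixed_point A eta xs ys ->
  simplex n x -> simplex m y ->
  eta * (kl x xs + kl y ys) <= gap x y.
Proof.
rewrite /fixed_point logit_xE// logit_yE// => -[xsE ysE] sx sy.
have sxs : simplex n xs by rewrite -xsE; exact: softmax_simplex.
have sys : simplex m ys by rewrite -ysE; exact: softmax_simplex.
rewrite gapE// ler_pM2l//.
have h1 := lse_dual_le m0 (zy x) sys.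
have h2 := lse_dual_le n0 (zx y) sxs.
have := lse_gibbs n0 (zx ys) sx; rewrite xsE => h3.
have := lse_gibbs m0 (zy xs) sy; rewrite ysE => h4.
have := lse_dual_eq n0 (zx ys); rewrite xsE => h5.
have := lse_dual_eq m0 (zy xs); rewrite ysE => h6.
have cross x1 y1 : dot (zx y1) x1 = - dot (zy x1) y1.
  by rewrite dotNl !dotZl (dot_mulmx A x1 y1).
have c1 := cross x ys; have c2 := cross xs y; have c3 := cross xs ys.
move: h1 h2 h3 h4 h5 h6 c1 c2 c3.
move: (dot (zy x) ys) (dot (zx y) xs) (dot (zx ys) x) (dot (zy xs) y)
  (dot (zx ys) xs) (dot (zy xs) ys).
move: (lse (zy x)) (lse (zx y)) (lse (zx ys)) (lse (zy xs)).
move: (negent x) (negent y) (negent xs) (negent ys) (kl x xs) (kl y ys).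
by move=> *; lra.
Qed.

Lemma gap_small_close (r : R) x y xs ys : fixed_point A eta xs ys ->
  simplex n x -> simplex m y -> 0 <= r -> 4 * gap x y <= eta * r ^+ 2 ->
  (forall i, `|x i 0 - xs i 0| <= r) /\ (forall j, `|y j 0 - ys j 0| <= r).
Proof.
move=> fp sx sy r0 small; have lb := gap_ge_kl fp sx sy.
case: fp; rewrite logit_xE// logit_yE// => xsE ysE.
have sxs : simplex n xs by rewrite -xsE; exact: softmax_simplex.
have sys : simplex m ys by rewrite -ysE; exact: softmax_simplex.
have xs0 i : 0 < xs i 0 by rewrite -xsE softmax_gt0.
have ys0 j : 0 < ys j 0 by rewrite -ysE softmax_gt0.
have kx := kl_ge0 n0 sx sxs xs0; have ky := kl_ge0 m0 sy sys ys0.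
have tot : 4 * (kl x xs + kl y ys) <= r ^+ 2.
  rewrite -(ler_pM2l eta0) mulrCA; lra.
split=> i; rewrite -(ler_pXn2r (ltn0Sn 1)) ?nnegrE// real_normK ?num_real//.
- have := kl_ge_sqr_coord i sx sxs xs0; lra.
- have := kl_ge_sqr_coord i sy sys ys0; lra.
Qed.

Lemma logit_x_simplex y : simplex n (logit_x A eta y).
Proof. by rewrite logit_xE//; exact: softmax_simplex. Qed.

Lemma logit_y_simplex x : simplex m (logit_y A eta x).
Proof. by rewrite logit_yE//; exact: softmax_simplex. Qed.

Lemma logit_x_lb y i : simplex m y ->
  expR (- (2 * payoff_bound)) / n%:R <= logit_x A eta y i 0.
Proof.
move=> sy; rewrite logit_xE//; apply: softmax_lb => // k.
by rewrite (le_trans (zx_bound _ _))// l1norm_simplex// mulr1.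
Qed.

Lemma logit_y_lb x j : simplex n x ->
  expR (- (2 * payoff_bound)) / m%:R <= logit_y A eta x j 0.
Proof.
move=> sx; rewrite logit_yE//; apply: softmax_lb => // k.
by rewrite (le_trans (zy_bound _ _))// l1norm_simplex// mulr1.
Qed.

Lemma logit_x_perturb y y' i :
  `|logit_x A eta y' i 0 - logit_x A eta y i 0| <=
  (expR (2 * (payoff_bound * l1norm (y' - y))) - 1) * logit_x A eta y i 0.
Proof.
rewrite !logit_xE//.
have -> : zx y' = zx y + zx (y' - y).
  by rewrite -opprD -scalerDr -mulmxDr subrKC.
by apply: softmax_perturb => // k; exact: zx_bound.
Qed.

Lemma logit_y_perturb x x' j :
  `|logit_y A eta x' j 0 - logit_y A eta x j 0| <=
  (expR (2 * (payoff_bound * l1norm (x' - x))) - 1) * logit_y A eta x j 0.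
Proof.
rewrite !logit_yE//.
have -> : zy x' = zy x + zy (x' - x) by rewrite -scalerDr -mulmxDr subrKC.
by apply: softmax_perturb => // k; exact: zy_bound.
Qed.

Lemma dnegent_bound k (x : 'cV[R]_k) (e : R) i : simplex k x -> 0 < e ->
  e <= x i 0 -> `|dnegent x i 0| <= 1 - ln e.
Proof.
move=> sx e0 ex; have x0 : 0 < x i 0 by apply: lt_le_trans ex.
have l1 : ln e <= ln (x i 0) by rewrite ler_ln.
have l2 : ln (x i 0) <= 0 by rewrite ln_le0// simplex_le1.
by rewrite mxE ler_norml; lra.
Qed.

Lemma gap_grad_x_bound x (e : R) i : simplex n x -> 0 < e -> e <= x i 0 ->
  `|gap_grad_x A eta x i 0| <= payoff_bound + (1 - ln e).
Proof.
move=> sx e0 ex; rewrite mxE (le_trans (ler_normD _ _))// lerD//; last first.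
  exact: dnegent_bound.
have := zx_bound (logit_y A eta x) i; rewrite mxE normrN => /le_trans; apply.
by rewrite l1norm_simplex ?mulr1//; exact: logit_y_simplex.
Qed.

Lemma gap_grad_y_bound y (e : R) j : simplex m y -> 0 < e -> e <= y j 0 ->
  `|gap_grad_y A eta y j 0| <= payoff_bound + (1 - ln e).
Proof.
move=> sy e0 ey; rewrite mxE (le_trans (ler_normD _ _))// lerD//; last first.
  exact: dnegent_bound.
have := zy_bound (logit_x A eta y) j; rewrite [X in _ -> `|X| <= _]mxE normrN.
move=> /le_trans; apply.
by rewrite l1norm_simplex ?mulr1//; exact: logit_x_simplex.
Qed.

Lemma dot_le_bound k (g u w : 'cV[R]_k) (G th : R) : simplex k w -> 0 <= th ->
  (forall i, `|g i 0| <= G) -> (forall i, `|u i 0| <= th * w i 0) ->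
  dot g u <= G * th.
Proof.
move=> [w0 w1] th0 gG uth; rewrite -[leRHS]mulr1 -w1 mulr_sumr.
apply: ler_sum => i _; apply: le_trans (ler_norm _) _.
by rewrite normrM -mulrA ler_pM.
Qed.

(** The mean process moves towards the responses to (x, y), not to its own
    position (u, v).  The mismatch is controlled by the perturbation bounds,
    so th measures how far the noise has pushed (x, y) away from (u, v). *)
Lemma mean_process_step (x u : 'cV[R]_n) (y v : 'cV[R]_m) (al e th : R) :
  0 <= al <= 1 -> 0 < e -> 0 <= th ->
  simplex n x -> simplex m y -> simplex n u -> simplex m v ->
  (forall i, e <= u i 0) -> (forall j, e <= v j 0) ->
  expR (2 * (payoff_bound * l1norm (y - v))) - 1 <= th ->
  expR (2 * (payoff_bound * l1norm (x - u))) - 1 <= th ->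
  gap ((1 - al) *: u + al *: logit_x A eta y)
      ((1 - al) *: v + al *: logit_y A eta x)
  <= (1 - al) * gap u v
    + al * (eta * (2 * (payoff_bound + (1 - ln e)) * th))
    + 2 * eta * (2 / e + 2 / e + 2 * (norm_1oo A ^+ 2 / eta ^+ 2)) * al ^+ 2.
Proof.
move=> al01 e0 th0 sx sy su sv ue ve yth xth.
have e20 : 0 <= 2 / e by rewrite divr_ge0 ?(ltW e0).
have u0 i : 0 < u i 0 by apply: lt_le_trans (ue i).
have v0 j : 0 < v j 0 by apply: lt_le_trans (ve j).
have swx := logit_x_simplex y; have swy := logit_y_simplex x.
have su' := simplex_convex al01 su swx.
have sv' := simplex_convex al01 sv swy.
have := gap_step A eta0 n0 m0 al01 e20 e20 su swx sv swy u0 v0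
  (negent_quad_ub e0 ue (fun i => simplex_ge0 i su'))
  (negent_quad_ub e0 ve (fun i => simplex_ge0 i sv')).
move/le_trans; apply; rewrite lerD2r lerD2l.
case/andP: al01 => al0 _; rewrite ler_wpM2l// ler_pM2l//.
have -> : 2 * (payoff_bound + (1 - ln e)) * th
  = (payoff_bound + (1 - ln e)) * th + (payoff_bound + (1 - ln e)) * th by ring.
apply: lerD.
- apply: (dot_le_bound (logit_x_simplex v)) => // i.
    exact: gap_grad_x_bound.
  rewrite 2!mxE; apply: le_trans (logit_x_perturb v y i) _.
  by rewrite ler_wpM2r// simplex_ge0//; exact: logit_x_simplex.
- apply: (dot_le_bound (logit_y_simplex u)) => // j.
    exact: gap_grad_y_bound.
  rewrite 2!mxE; apply: le_trans (logit_y_perturb u x j) _.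
  by rewrite ler_wpM2r// simplex_ge0//; exact: logit_y_simplex.
Qed.

End GapBounds.

(** * Convergence of the dynamics under small noise *)

Section Tracking.
Context {R : realType} {m n : nat}.
Variables (A : 'M[R]_(m, n)) (eta : R).
Hypotheses (eta0 : 0 < eta) (n0 : (0 < n)%N) (m0 : (0 < m)%N).

Local Notation gap := (duality_gap A eta).
Local Notation gmax := (duality_gap_max A eta).
Local Notation step t := (2 / (t%:R + 2) : R).

Definition coord_close {k : nat} (r : R) (p q : 'cV[R]_k) : Prop :=
  forall i, `|p i 0 - q i 0| <= r.

Lemma step01 t : 0 <= step t <= 1.
Proof.
have t0 : 0 <= t%:R :> R by rewrite ler0n.
by rewrite divr_ge0 ?addr_ge0//= ler_pdivrMr; lra.
Qed.

Lemma coord_close_l1norm k (r : R) (p q : 'cV[R]_k) :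
  coord_close r p q -> l1norm (p - q) <= k%:R * r.
Proof.
move=> pq; apply: (@le_trans _ _ (\sum_(i < k) r)).
  by apply: ler_sum => i _; rewrite !mxE; exact: pq.
by rewrite sumr_const card_ord mulr_natl.
Qed.

(** The first step size is 1, which erases the starting vertex; from then on
    the iterates are convex combinations of the points w s. *)
Lemma convex_iter_lb k (u w : nat -> 'cV[R]_k) (e : R) :
  (forall s i, e <= w s i 0) ->
  (forall s, u s.+1 = (1 - step s) *: u s + step s *: w s) ->
  forall s i, e <= u s.+1 i 0.
Proof.
move=> we uS; elim=> [|s IH] i; rewrite uS !mxE.
  by rewrite add0r divff ?pnatr_eq0// subrr mul0r add0r mul1r.
have /andP[a0 a1] := step01 s.+1.
have h1 := ler_wpM2l a0 (we s.+1 i).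
have a1' : 0 <= 1 - step s.+1 by rewrite subr_ge0.
have h2 := ler_wpM2l a1' (IH i).
lra.
Qed.

Lemma convex_iter_simplex k (u w : nat -> 'cV[R]_k) : simplex k (u 0) ->
  (forall s, simplex k (w s)) ->
  (forall s, u s.+1 = (1 - step s) *: u s + step s *: w s) ->
  forall s, simplex k (u s).
Proof.
move=> u0 ws uS; elim=> [//|s IH]; rewrite uS.
by apply: simplex_convex => //; exact: step01.
Qed.

(** Once the noise is small from time tau on, the Lyapunov recursion for the
    mean process can be started at tau, where the gap is at most its maximum;
    at times beyond k * tau the weight of that initial value is at most 1/k.
    The mean process stays a fixed distance away from the boundary, so the
    unbounded curvature of the entropy is harmless here. *)
Lemma mean_tracking xs ys (rho : R) : fixed_point A eta xs ys -> 0 < rho ->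
  exists c : R, exists k : nat, [/\ 0 < c, (0 < k)%N &
  forall (x u : nat -> 'cV[R]_n) (y v : nat -> 'cV[R]_m) (tau : nat),
  (forall s, simplex n (x s)) -> (forall s, simplex m (y s)) ->
  simplex n (u 0) -> simplex m (v 0) ->
  (forall s, u s.+1 = (1 - step s) *: u s + step s *: logit_x A eta (y s)) ->
  (forall s, v s.+1 = (1 - step s) *: v s + step s *: logit_y A eta (x s)) ->
  (0 < tau)%N ->
  (forall s, (tau <= s)%N ->
    coord_close c (x s) (u s) /\ coord_close c (y s) (v s)) ->
  forall t, (k * tau <= t)%N ->
    coord_close rho (x t) xs /\ coord_close rho (y t) ys].
Proof.
move=> fp rho0.
have nR : 0 < n%:R :> R by rewrite ltr0n.
have mR : 0 < m%:R :> R by rewrite ltr0n.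
pose pb := payoff_bound A eta.
have pb0 : 0 <= pb by exact: payoff_bound_ge0.
pose e := Num.min (expR (- (2 * pb)) / n%:R) (expR (- (2 * pb)) / m%:R).
have e0 : 0 < e by rewrite lt_min !divr_gt0 ?expR_gt0.
pose G := eta * (2 * (pb + (1 - ln e))).
pose C := 2 * eta * (2 / e + 2 / e + 2 * (norm_1oo A ^+ 2 / eta ^+ 2)).
have C0 : 0 <= C.
  have kap0 : 0 <= norm_1oo A ^+ 2 / eta ^+ 2 by rewrite divr_ge0 ?sqr_ge0.
  have e20 : 0 <= 2 / e by rewrite divr_ge0 ?(ltW e0).
  by rewrite /C mulr_ge0 ?mulr_ge0 ?(ltW eta0)// !addr_ge0// mulr_ge0.
pose r := rho / 2.
have r0 : 0 < r by rewrite divr_gt0.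
pose th := eta * r ^+ 2 / 8 / (`|G| + 1).
have target0 : 0 < eta * r ^+ 2 / 8 by rewrite divr_gt0// mulr_gt0// exprn_gt0.
have th0 : 0 < th by rewrite divr_gt0// ltr_wpDl.
have Gth : G * th <= eta * r ^+ 2 / 8.
  rewrite /th mulrA ler_pdivrMr ?ltr_wpDl// mulrC ler_wpM2l ?(ltW target0)//.
  by rewrite (le_trans (ler_norm _))// lerDl.
pose N : R := n%:R + m%:R.
have N0 : 0 < N by rewrite addr_gt0.
have lnth : 0 < ln (1 + th) by rewrite ln_gt0// ltrDl.
have den0 : 0 < 2 * pb * N + 1 by rewrite ltr_wpDl// mulr_ge0 ?(ltW N0)// mulr_ge0.
pose c := Num.min r (ln (1 + th) / (2 * pb * N + 1)).
have c0 : 0 < c by rewrite lt_min r0 divr_gt0.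
have cr : c <= r by rewrite ge_min lexx.
have cth : 2 * pb * N * c <= ln (1 + th).
  have : c * (2 * pb * N + 1) <= ln (1 + th).
    by rewrite -ler_pdivlMr// ge_min lexx orbT.
  lra.
have exp_small (l : R) : l <= N * c -> expR (2 * (pb * l)) - 1 <= th.
  move=> lN; rewrite lerBlDl -[leRHS]lnK ?posrE ?addr_gt0//.
  rewrite ler_expR; apply: le_trans cth.
  by rewrite mulrA -(mulrA _ N) ler_wpM2l// mulr_ge0.
pose B := (`|gmax| + 4 * C) / (eta * r ^+ 2 / 8).
have B0 : 0 <= B by rewrite divr_ge0 ?(ltW target0)// addr_ge0// mulr_ge0.
have [k k0 Bk] : exists2 k : nat, (0 < k)%N & B <= k%:R.
  exists (Num.bound B).+1 => //; apply: ltW; apply: lt_trans (archi_boundP B0) _.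
  by rewrite ltr_nat.
exists c, k; split=> // x u y v tau sx sy su0 sv0 uS vS tau0 cl.
have su : forall s, simplex n (u s).
  by apply: (convex_iter_simplex su0 _ uS) => s; exact: logit_x_simplex.
have sv : forall s, simplex m (v s).
  by apply: (convex_iter_simplex sv0 _ vS) => s; exact: logit_y_simplex.
have ue s i : e <= u s.+1 i 0.
  apply: (convex_iter_lb _ uS) => {}s {}i.
  by rewrite ge_min logit_x_lb.
have ve s j : e <= v s.+1 j 0.
  apply: (convex_iter_lb _ vS) => {}s {}j.
  by rewrite ge_min logit_y_lb// orbT.
pose D s := gap (u s) (v s).
have Dstep s : (tau <= s)%N -> D s.+1 <= (1 - step s) * D s + step s * (G * th)
     + C * step s ^+ 2.
  move=> taus; rewrite /D uS vS.
  have -> : G * th = eta * (2 * (pb + (1 - ln e)) * th) by rewrite mulrA.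
  have [clx cly] := cl _ taus.
  have s1 : s = s.-1.+1 by rewrite prednK// (leq_trans tau0).
  apply: mean_process_step => //.
  - exact: step01.
  - exact: ltW.
  - by move=> i; rewrite s1.
  - by move=> j; rewrite s1.
  - apply: exp_small; apply: le_trans (coord_close_l1norm cly) _.
    by rewrite ler_wpM2r ?(ltW c0)// lerDr ltW.
  - apply: exp_small; apply: le_trans (coord_close_l1norm clx) _.
    by rewrite ler_wpM2r ?(ltW c0)// lerDl ltW.
move=> t kt.
have taut : (tau <= t)%N by apply: leq_trans kt; rewrite leq_pmull.
have := @weighted_recursion R D (fun=> G * th) C tau t C0 taut
  (fun s st => Dstep s (proj1 (andP st))).
have sumE : \sum_(tau <= s < t) 2 * (s%:R + 1) * (G * th)
   = (t%:R * (t%:R + 1) - tau%:R * (tau%:R + 1)) * (G * th) :> R.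
  rewrite -mulr_suml; congr (_ * _).
  rewrite -(@telescope_sumr R tau t (fun s => s%:R * (s%:R + 1)))//.
  by apply: eq_bigr => s _; rewrite -[s.+1%:R]natr1; ring.
rewrite sumE => rec.
have tR : 0 < t%:R :> R by rewrite ltr0n (leq_trans tau0).
have tauR : 0 < tau%:R :> R by rewrite ltr0n.
have tautR : tau%:R <= t%:R :> R by rewrite ler_nat.
have kR : 0 < k%:R :> R by rewrite ltr0n.
have ktR : k%:R * tau%:R <= t%:R :> R by rewrite -natrM ler_nat.
have Dtau : D tau <= `|gmax|.
  by apply: le_trans (ler_norm _); exact: gap_le_max.
have tt0 : 0 < t%:R * (t%:R + 1) :> R by rewrite mulr_gt0 ?ltr_wpDr.
have Dt : D t <= (`|gmax| + 4 * C) / k%:R + eta * r ^+ 2 / 8.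
  rewrite -(ler_pM2l tt0) (le_trans rec)//.
  set T8 := eta * r ^+ 2 / 8 in target0 Gth *; set X := t%:R * (t%:R + 1) in tt0 *.
  have q1 : tau%:R * (tau%:R + 1) * D tau <= X * `|gmax| / k%:R.
    rewrite ler_pdivlMr//.
    apply: (@le_trans _ _ (tau%:R * (tau%:R + 1) * `|gmax| * k%:R)).
      by rewrite ler_wpM2r ?(ltW kR)// ler_wpM2l// mulr_ge0 ?addr_ge0.
    rewrite mulrAC ler_wpM2r// mulrAC (mulrC tau%:R).
    by rewrite ler_pM ?mulr_ge0 ?addr_ge0 ?lerD2r.
  have q2 : (X - tau%:R * (tau%:R + 1)) * (G * th) <= X * T8.
    have d0 : 0 <= X - tau%:R * (tau%:R + 1).
      by rewrite subr_ge0 ler_pM ?addr_ge0 ?lerD2r.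
    apply: le_trans (ler_wpM2l d0 Gth) _; rewrite ler_wpM2r ?(ltW target0)//.
    by rewrite gerBl mulr_ge0 ?addr_ge0.
  have q3 : 4 * C * (t%:R - tau%:R) <= X * (4 * C) / k%:R.
    have -> : X * (4 * C) / k%:R = 4 * C * (X / k%:R) by ring.
    apply: ler_wpM2l; first by rewrite mulr_ge0.
    rewrite ler_pdivlMr// mulrC.
    have kt1 : k%:R <= t%:R :> R.
      by apply: le_trans ktR; rewrite ler_peMr ?(ltW kR)// ler1n.
    rewrite ler_pM ?subr_ge0//.
    by rewrite lerBlDr -addrA lerDl addr_ge0 ?(ltW tauR).
  have -> : X * ((`|gmax| + 4 * C) / k%:R + T8)
     = X * `|gmax| / k%:R + X * T8 + X * (4 * C) / k%:R by ring.
  by rewrite !lerD.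
have Dsmall : 4 * gap (u t) (v t) <= eta * r ^+ 2.
  have kB : (`|gmax| + 4 * C) / k%:R <= eta * r ^+ 2 / 8.
    by move: Bk; rewrite /B !ler_pdivrMr// [k%:R * _]mulrC.
  rewrite -[leRHS](@divfK _ 8)// -/(D t).
  move: (eta * r ^+ 2 / 8) Dt kB => T8.
  move: (D t) (_ / k%:R) => d q ? ?; lra.
have [ux vy] := gap_small_close eta0 n0 m0 fp (su t) (sv t) (ltW r0) Dsmall.
have [clx cly] := cl _ taut.
have rr : rho = r + r by rewrite /r; field.
split=> i; rewrite rr.
  by rewrite (le_trans (ler_distD (u t i 0) _ _))// lerD// (le_trans (clx i)).
by rewrite (le_trans (ler_distD (v t i 0) _ _))// lerD// (le_trans (cly i)).
Qed.

End Tracking.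

(** * Finitely valued random variables *)

Section FiniteValued.
Context {Omega : Type}.
Implicit Types (F G : set (set Omega)).

(** Each iterate takes finitely many values, so a random variable that factors
    through a finite type with fibres in F is enough: such variables are stable
    under composition with arbitrary, possibly non-measurable, functions. *)
Definition finite_rv F {V : Type} (Z : Omega -> V) : Prop :=
  exists (T : finType) (H : Omega -> T) (phi : T -> V),
    (forall h, F (H @^-1` [set h])) /\ forall w, Z w = phi (H w).

Lemma finite_rv_sub F G V (Z : Omega -> V) : F `<=` G ->
  finite_rv F Z -> finite_rv G Z.
Proof.
by move=> FG [T [H [phi [FH ZE]]]]; exists T, H, phi; split=> // h; exact: FG.
Qed.

Lemma finite_rv_comp F V W (f : V -> W) (Z : Omega -> V) :
  finite_rv F Z -> finite_rv F (fun w => f (Z w)).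
Proof.
by move=> [T [H [phi [FH ZE]]]]; exists T, H, (f \o phi); split=> // w; rewrite ZE.
Qed.

Variable F : set (set Omega).
Hypothesis sF : sigma_algebra setT F.

Lemma sigmaC B : F B -> F (~` B).
Proof. by case: sF => _ + _ => /[apply]; rewrite setTD. Qed.

Lemma sigmaU A B : F A -> F B -> F (A `|` B).
Proof.
move=> FA FB; case: sF => F0 _ FU; rewrite -bigcup2E.
by apply: FU => -[|[|k]].
Qed.

Lemma sigmaI A B : F A -> F B -> F (A `&` B).
Proof.
by move=> FA FB; rewrite -[A `&` B]setCK setCI; apply/sigmaC/sigmaU; exact: sigmaC.
Qed.

Lemma sigmaT : F setT.
Proof. by rewrite -setC0; apply: sigmaC; case: sF. Qed.

Lemma finite_rv_preimage V (Z : Omega -> V) (B : set V) :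
  finite_rv F Z -> F (Z @^-1` B).
Proof.
move=> [T [H [phi [FH ZE]]]].
have -> : Z @^-1` B = \big[setU/set0]_(h | `[< B (phi h) >]) (H @^-1` [set h]).
  apply/seteqP; split=> [w /=|w]; rewrite -bigcup_seq_cond/=.
    by rewrite ZE => Bw; exists (H w) => //=; rewrite mem_index_enum; apply/asboolP.
  by move=> [h /= /andP[_ /asboolP Bh] Hw]; rewrite ZE Hw.
elim/big_rec: _ => [|h X _ FX]; first by case: sF.
exact: sigmaU.
Qed.

Lemma finite_rv_cst V (v : V) : finite_rv F (fun=> v).
Proof.
exists unit, (fun=> tt), (fun=> v); split=> // -[].
have -> : (fun=> tt) @^-1` [set tt] = [set: Omega] by apply/seteqP; split.
exact: sigmaT.
Qed.

Lemma finite_rv_pair V W (Z : Omega -> V) (Y : Omega -> W) :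
  finite_rv F Z -> finite_rv F Y -> finite_rv F (fun w => (Z w, Y w)).
Proof.
move=> [T [H [phi [FH ZE]]]] [T' [H' [phi' [FH' YE]]]].
exists (T * T')%type, (fun w => (H w, H' w)), (fun h => (phi h.1, phi' h.2)).
split=> [[h h']|w]; last by rewrite ZE YE.
have -> : (fun w => (H w, H' w)) @^-1` [set (h, h')]
  = H @^-1` [set h] `&` H' @^-1` [set h'].
  by apply/seteqP; split=> w /= [-> ->].
exact: sigmaI.
Qed.

Lemma finite_rv_op V W X (f : V -> W -> X) (Z : Omega -> V) (Y : Omega -> W) :
  finite_rv F Z -> finite_rv F Y -> finite_rv F (fun w => f (Z w) (Y w)).
Proof.
move=> FZ FY.
exact: (finite_rv_comp (fun p => f p.1 p.2) (finite_rv_pair FZ FY)).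
Qed.

Lemma finite_rv_sum (V : nmodType) (I : Type) (r : seq I) (Z : I -> Omega -> V) :
  (forall i, finite_rv F (Z i)) -> finite_rv F (fun w => \sum_(i <- r) Z i w).
Proof.
move=> FZ; elim: r => [|i r IH].
  under eq_fun do rewrite big_nil; exact: finite_rv_cst.
under eq_fun do rewrite big_cons.
exact: (finite_rv_op +%R (FZ i) IH).
Qed.

Lemma finite_rv_indic (R : realType) (A : set Omega) : F A ->
  finite_rv F (\1_A : Omega -> R).
Proof.
move=> FA; exists bool, (fun w => w \in A), (fun b : bool => b%:R); split=> //.
case.
  have -> : (fun w => w \in A) @^-1` [set true] = A; last by [].
  by apply/seteqP; split=> w /=; [move/set_mem|move/mem_set].
have -> : (fun w => w \in A) @^-1` [set false] = ~` A; last exact: sigmaC.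
apply/seteqP; split=> w /=; first by move=> /negbT/negP h /mem_set.
by move=> h; apply/negbTE/negP => /set_mem.
Qed.

End FiniteValued.

Section Expectation.
Context {d : measure_display} {Omega : measurableType d} {R : realType}.
Variable P : probability Omega R.
Implicit Types (Z Y : Omega -> R) (A B E : set Omega).

Lemma sigma_measurable : sigma_algebra setT (@measurable d Omega).
Proof.
split; first exact: measurable0.
- by move=> A mA; exact: measurableD.
- by move=> A mA; exact: bigcup_measurable.
Qed.
Let sM := sigma_measurable.

Definition Ex Z : R := \int[P]_w Z w.

Lemma finite_rv_integrable D Z : measurable D -> finite_rv measurable Z ->
  P.-integrable D (EFin \o Z).
Proof.
move=> mD fZ; apply: measurable_bounded_integrable => //.
- by rewrite (le_lt_trans (probability_le1 P mD))// ltry.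
- move=> _ B mB; apply: measurableI => //.
  exact: (finite_rv_preimage sM B fZ).
- case: fZ => T [H [phi [_ ZE]]].
  exists (\sum_h `|phi h|); split; first exact: num_real.
  move=> M MM w _; rewrite /= ZE (le_trans _ (ltW MM))//.
  by rewrite (bigD1 (H w))//= lerDl sumr_ge0.
Qed.

Lemma Ex_cst (c : R) : Ex (fun=> c) = c.
Proof.
rewrite /Ex Rintegral_cst// -[RHS]mulr1; congr (_ * _).
exact: (congr1 fine (probability_setT P)).
Qed.

Lemma ExD Z Y : finite_rv measurable Z -> finite_rv measurable Y ->
  Ex (fun w => Z w + Y w) = Ex Z + Ex Y.
Proof. by move=> fZ fY; rewrite /Ex RintegralD//; exact: finite_rv_integrable. Qed.

Lemma ExB Z Y : finite_rv measurable Z -> finite_rv measurable Y ->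
  Ex (fun w => Z w - Y w) = Ex Z - Ex Y.
Proof. by move=> fZ fY; rewrite /Ex RintegralB//; exact: finite_rv_integrable. Qed.

Lemma ExZl (c : R) Z : finite_rv measurable Z -> Ex (fun w => c * Z w) = c * Ex Z.
Proof. by move=> fZ; rewrite /Ex RintegralZl//; exact: finite_rv_integrable. Qed.

Lemma Ex_sum (I : Type) (r : seq I) (Z : I -> Omega -> R) :
  (forall i, finite_rv measurable (Z i)) ->
  Ex (fun w => \sum_(i <- r) Z i w) = \sum_(i <- r) Ex (Z i).
Proof.
move=> fZ; elim: r => [|i r IH].
  by under eq_fun do rewrite big_nil; rewrite Ex_cst big_nil.
under eq_fun do rewrite big_cons.
by rewrite big_cons -IH ExD//; exact: finite_rv_sum.
Qed.

Lemma le_Ex Z Y : finite_rv measurable Z -> finite_rv measurable Y ->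
  (forall w, Z w <= Y w) -> Ex Z <= Ex Y.
Proof. by move=> fZ fY ZY; apply: le_Rintegral => //; exact: finite_rv_integrable. Qed.

Lemma Ex_restrict A Z : Ex (fun w => \1_A w * Z w) = \int[P]_(w in A) Z w.
Proof.
rewrite Rintegral_mkcond; apply: eq_Rintegral => w _.
by rewrite patchE indicE; case: ifP; rewrite ?mul1r ?mul0r.
Qed.

Lemma Ex_indic A : measurable A -> Ex \1_A = fine (P A).
Proof.
move=> mA; have -> : \1_A = (fun w => \1_A w * 1 : R) by apply/funext=> w; rewrite mulr1.
by rewrite Ex_restrict Rintegral_cst// mul1r.
Qed.

(** Extends the defining property of a conditional probability from events to
    test functions, by splitting along the finitely many fibres. *)
Lemma Ex_cond_prob (F : set (set Omega)) E g Z :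
  sigma_algebra setT F -> F `<=` measurable -> measurable E ->
  is_cond_prob P F E g -> finite_rv F g -> finite_rv F Z ->
  Ex (fun w => Z w * \1_E w) = Ex (fun w => Z w * g w).
Proof.
move=> sF FM mE [_ Eg] fg [T [H [phi [FH ZE]]]].
have fH h : finite_rv F (\1_(H @^-1` [set h]) : Omega -> R).
  exact: finite_rv_indic.
have fHM h := finite_rv_sub FM (fH h).
have decomp (Y : Omega -> R) w :
    Z w * Y w = \sum_h phi h * (\1_(H @^-1` [set h]) w * Y w).
  rewrite (bigD1 (H w))//= big1 => [|h hw].
    by rewrite addr0 ZE indicE mem_set// mul1r.
  by rewrite indicE memNset ?mul0r ?mulr0//= => e; rewrite e eqxx in hw.
have fYM Y h : finite_rv measurable Y ->
    finite_rv measurable (fun w => \1_(H @^-1` [set h]) w * Y w).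
  by move=> fY; exact: (finite_rv_op sM *%R (fHM h) fY).
have sumE Y : finite_rv measurable Y -> Ex (fun w => Z w * Y w)
    = \sum_h phi h * \int[P]_(w in H @^-1` [set h]) Y w.
  move=> fY; under [X in Ex X]eq_fun do rewrite decomp.
  rewrite Ex_sum => [|h].
    by apply: eq_bigr => h _; rewrite ExZl ?Ex_restrict//; exact: fYM.
  by apply: (finite_rv_comp ( *%R (phi h))); exact: fYM.
rewrite !sumE; [|exact: finite_rv_sub fg|exact: finite_rv_indic].
apply: eq_bigr => h _; congr (_ * _).
rewrite /Rintegral -Eg//; congr fine.
by rewrite -integral_indic//; exact: FM.
Qed.

Lemma fine_P_ge0 A : 0 <= fine (P A).
Proof. exact: fine_ge0. Qed.

Lemma fine_P_le1 A : measurable A -> fine (P A) <= 1.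
Proof.
move=> mA; rewrite -[leRHS]/(fine (1%E : \bar R)).
by rewrite fine_le ?fin_num_measure// probability_le1.
Qed.

Lemma fine_P_mono A B : measurable A -> measurable B -> A `<=` B ->
  fine (P A) <= fine (P B).
Proof.
move=> mA mB AB; rewrite fine_le ?fin_num_measure//.
by apply: le_measure; rewrite ?inE.
Qed.

Lemma fine_PC A : measurable A -> fine (P (~` A)) = 1 - fine (P A).
Proof.
by move=> mA; rewrite (probability_setC P mA) fineB ?fin_num_measure.
Qed.

Lemma fine_P_bigcup_le (A : nat -> set Omega) (b : R) :
  (forall k, measurable (A k)) ->
  (forall N, \sum_(0 <= k < N) fine (P (A k)) <= b) ->
  fine (P (\bigcup_k A k)) <= b.
Proof.
move=> mA Ab; have mU : measurable (\bigcup_k A k) by exact: bigcup_measurable.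
rewrite -lee_fin fineK ?fin_num_measure//.
apply: le_trans (generalized_Boole_inequality P mA mU) _.
apply: lime_le; first by apply: is_cvg_nneseries.
apply: nearW => N.
apply: le_trans (_ : _ <= (\sum_(0 <= k < N) fine (P (A k)))%:E)%E _.
  rewrite -sumEFin; apply: lee_sum => k _.
  by rewrite fineK ?fin_num_measure.
by rewrite lee_fin.
Qed.

Lemma fine_P_setU_le A B : measurable A -> measurable B ->
  fine (P (A `|` B)) <= fine (P A) + fine (P B).
Proof.
move=> mA mB; rewrite -bigcup2E; apply: fine_P_bigcup_le => [k|N].
  by case: k => [|[|k]] //=; exact: measurable0.
case: N => [|[|N]].
- by rewrite big_geq// addr_ge0// fine_P_ge0.
- by rewrite big_nat1/= lerDl fine_P_ge0.
- rewrite 2?big_nat_recl//= big1 ?addr0// => k _.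
  by rewrite measure0.
Qed.

Lemma fine_P_fin_bigcup_le (I : finType) (A : I -> set Omega) :
  (forall i, measurable (A i)) ->
  fine (P (\bigcup_(i in [set: I]) A i)) <= \sum_i fine (P (A i)).
Proof.
move=> mA; have -> : \bigcup_(i in [set: I]) A i = \big[setU/set0]_i A i.
  rewrite -bigcup_seq; apply: eq_bigcupl; split=> i //= _; exact: mem_index_enum.
elim: (index_enum I) => [|i r IH].
  by rewrite !big_nil measure0.
rewrite !big_cons; apply: le_trans (fine_P_setU_le _ _) _ => //.
  by apply: bigsetU_measurable.
by rewrite lerD2l.
Qed.

End Expectation.

(** * Concentration of weighted martingale sums *)

Section Azuma.
Context {d : measure_display} {Omega : measurableType d} {R : realType}.
Variable P : probability Omega R.

(** Hoeffding's bound for a centred Bernoulli variable of parameter g: the two-point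
    bound, recentred.  Negative a swaps the two outcomes. *)
Lemma bernoulli_mgf (g a : R) :
  g * expR (a * (1 - g)) + (1 - g) * expR (- (a * g)) <= expR (a ^+ 2 / 8).
Proof.
have half (q r b : R) : q + r = 1 -> 0 <= b ->
    q * expR (2 * b * r) + r * expR (- (2 * b * q)) <= expR (b ^+ 2 / 2).
  move=> qr b0; have := two_point_mgf qr b0.
  move=> /(ler_wpM2l (expR_ge0 (b * (r - q)))).
  rewrite mulrDr !(mulrCA (expR (b * _))) -!expRD.
  have rE : r = 1 - q by rewrite -qr; ring.
  have -> : b * (r - q) + b = 2 * b * r by rewrite rE; ring.
  have -> : b * (r - q) + - b = - (2 * b * q) by rewrite rE; ring.
  by have -> : b * (r - q) + ((q - r) * b + b ^+ 2 / 2) = b ^+ 2 / 2 by ring.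
have [a0|/ltW a0] := leP 0 a.
  have := half g (1 - g) (a / 2) (subrKC _ _) (divr_ge0 a0 (ler0n _ _)).
  have -> : 2 * (a / 2) = a by field.
  by have -> : (a / 2) ^+ 2 / 2 = a ^+ 2 / 8 by field.
have a0' : 0 <= - a / 2 by rewrite divr_ge0 ?oppr_ge0.
have := half (1 - g) g (- a / 2) (subrK _ _) a0'.
have -> : 2 * (- a / 2) = - a by field.
have -> : (- a / 2) ^+ 2 / 2 = a ^+ 2 / 8 by field.
by rewrite mulNr mulNr opprK addrC.
Qed.

Variables (F : nat -> set (set Omega)) (E : nat -> set Omega)
  (g : nat -> Omega -> R).
Hypotheses (sF : forall t, sigma_algebra setT (F t))
  (FM : forall t, F t `<=` measurable)
  (Fmono : forall s t, (s <= t)%N -> F s `<=` F t)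
  (FE : forall t, F t.+1 (E t))
  (Eg : forall t, is_cond_prob P (F t) (E t) (g t))
  (Fg : forall t, finite_rv (F t) (g t)).

Definition increment t (w : Omega) : R := \1_(E t) w - g t w.

Let sM := @sigma_measurable d Omega.

Lemma finite_rv_increment s t : (s < t)%N -> finite_rv (F t) (increment s).
Proof.
move=> st; apply: (finite_rv_op (sF t) (fun u v : R => u - v)).
  by apply: (finite_rv_indic (sF t)); apply: Fmono st _ (FE s).
exact: finite_rv_sub (Fmono (ltnW st)) (Fg s).
Qed.

Lemma finite_rv_wsum (a : nat -> R) s t : (s <= t)%N ->
  finite_rv (F t) (fun w => \sum_(k < s) a k * increment k w).
Proof.
move=> st; apply: (finite_rv_sum (sF t)) => k.
apply: (finite_rv_comp ( *%R (a k))); apply: finite_rv_increment.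
exact: leq_trans (ltn_ord k) st.
Qed.

(** Azuma-Hoeffding.  On the event and on its complement the next factor is a
    function of the past, so conditioning replaces the indicator by g and the
    Bernoulli bound applies pointwise. *)
Lemma Ex_exp_martingale (a : nat -> R) t :
  Ex P (fun w => expR (\sum_(s < t) a s * increment s w))
  <= expR (\sum_(s < t) a s ^+ 2 / 8).
Proof.
elim: t => [|t IH].
  under eq_fun do rewrite big_ord0.
  by rewrite Ex_cst big_ord0.
pose Z w := expR (\sum_(s < t) a s * increment s w).
have FZ : finite_rv (F t) Z by apply: finite_rv_comp; exact: finite_rv_wsum.
pose lo w := Z w * expR (- (a t * g t w)).
pose df w := Z w * (expR (a t * (1 - g t w)) - expR (- (a t * g t w))).
have Flo : finite_rv (F t) lo.
  by apply: (finite_rv_op (sF t) (fun u v => u * expR (- (a t * v)))).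
have Fdf : finite_rv (F t) df.
  by apply: (finite_rv_op (sF t)
    (fun u v => u * (expR (a t * (1 - v)) - expR (- (a t * v))))).
have mE : measurable (E t) by exact: FM (FE t).
have M V (Y : Omega -> V) : finite_rv (F t) Y -> finite_rv measurable Y.
  exact/finite_rv_sub/FM.
have split : (fun w => expR (\sum_(s < t.+1) a s * increment s w))
    = (fun w => lo w + df w * \1_(E t) w).
  apply/funext => w; rewrite big_ord_recr/= expRD -/(Z w) /lo /df /increment.
  rewrite indicE; case: (w \in E t) => /=; rewrite ?mulr1 ?mulr0 ?addr0.
    by ring.
  by rewrite sub0r mulrN.
have Fdg : finite_rv (F t) (fun w => df w * g t w).
  exact: (finite_rv_op (sF t) *%R Fdf (Fg t)).
rewrite split ExD; [|exact: M|]; last first.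
  by apply: (finite_rv_op sM *%R (M _ _ Fdf)); exact: finite_rv_indic.
rewrite (Ex_cond_prob (sF t) (FM (t:=t)) mE (Eg t) (Fg t) Fdf).
rewrite -ExD; [|exact: M|exact: M].
rewrite big_ord_recr/= expRD mulrC.
apply: le_trans (ler_wpM2l (expR_ge0 _) IH).
rewrite -ExZl; last exact: M.
apply: le_Ex.
- exact: M (finite_rv_op (sF t) +%R Flo Fdg).
- by apply: M; apply: (finite_rv_comp ( *%R _)).
move=> w; rewrite -/(Z w).
have -> : lo w + df w * g t w = Z w * (g t w * expR (a t * (1 - g t w))
    + (1 - g t w) * expR (- (a t * g t w))) by rewrite /lo /df; ring.
by rewrite mulrC ler_wpM2r ?expR_ge0// bernoulli_mgf.
Qed.

(** The distance between an iterate and its mean process is such an average;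
    the weights are those that the step sizes 2/(t+2) produce. *)
Definition noise t (w : Omega) : R :=
  (\sum_(s < t) 2 * (s%:R + 1) * increment s w) / (t%:R * (t%:R + 1)).

Lemma finite_rv_noise t : finite_rv (F t) (noise t).
Proof.
apply: (finite_rv_comp (fun v => v / (t%:R * (t%:R + 1)))).
exact: (finite_rv_wsum (fun s => 2 * (s%:R + 1))).
Qed.

(** Markov's inequality for the exponential moment with parameter c t; the sign
    sg handles both tails at once. *)
Lemma noise_one_sided_tail (c sg : R) t : 0 < c -> (0 < t)%N -> sg ^+ 2 = 1 ->
  fine (P [set w | c <= sg * noise t w]) <= expR (- (c ^+ 2 * t%:R / 2)).
Proof.
move=> c0 t0 sg1; set B := [set w | _].
have tR : 0 < t%:R :> R by rewrite ltr0n.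
have fN := finite_rv_sub (FM (t:=t)) (finite_rv_noise t).
have mB : measurable B.
  by apply: (finite_rv_preimage sM [set v | c <= sg * v] fN).
have fB : finite_rv measurable (\1_B : Omega -> R) by exact: finite_rv_indic.
pose th := c * t%:R.
have th0 : 0 < th by rewrite mulr_gt0.
pose a s := sg * th * (2 * (s%:R + 1)) / (t%:R * (t%:R + 1)).
have aE w : th * (sg * noise t w) = \sum_(s < t) a s * increment s w.
  rewrite /noise mulr_suml !mulr_sumr; apply: eq_bigr => s _; rewrite /a; ring.
have := Ex_exp_martingale a t.
have asum : \sum_(s < t) a s ^+ 2 / 8 <= c ^+ 2 * t%:R / 2.
  apply: (@le_trans _ _ (\sum_(s < t) c ^+ 2 / 2)); last first.
    by rewrite sumr_const card_ord -[_ *+ t]mulr_natr mulrAC.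
  apply: ler_sum => s _.
  have st : s%:R + 1 <= t%:R :> R by rewrite natr1 ler_nat ltn_ord.
  have -> : a s ^+ 2 / 8 = c ^+ 2 / 2 * ((s%:R + 1) / (t%:R + 1)) ^+ 2.
    rewrite /a /th 4!exprMn sg1; field.
    by rewrite !gt_eqF// ltr_wpDr.
  rewrite ler_piMr ?divr_ge0 ?sqr_ge0// exprn_ile1 ?divr_ge0 ?addr_ge0//.
  by rewrite ler_pdivrMr ?ltr_wpDr// mul1r (le_trans st)// lerDl.
move=> /le_trans /(_ _); rewrite -ler_expR in asum => /(_ _ asum).
have markov : expR (th * c) * Ex P \1_B <= Ex P
    (fun w => expR (\sum_(s < t) a s * increment s w)).
  rewrite -ExZl//; apply: le_Ex.
  - exact: (finite_rv_comp ( *%R _)).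
  - apply: finite_rv_comp.
    exact: finite_rv_sub (FM (t:=t)) (finite_rv_wsum a (leqnn t)).
  - move=> w; rewrite -aE indicE; case: (boolP (w \in B)) => [/set_mem wB|_].
      by rewrite mulr1 ler_expR ler_pM2l.
    by rewrite mulr0 expR_ge0.
move=> /(le_trans markov).
rewrite Ex_indic// -ler_pdivlMl ?expR_gt0// -expRN -expRD.
have -> // : - (th * c) + c ^+ 2 * t%:R / 2 = - (c ^+ 2 * t%:R / 2).
by rewrite /th; field.
Qed.

Lemma noise_tail (c : R) t : 0 < c -> (0 < t)%N ->
  fine (P [set w | c < `|noise t w|]) <= 2 * expR (- (c ^+ 2 * t%:R / 2)).
Proof.
move=> c0 t0.
have fN := finite_rv_sub (FM (t:=t)) (finite_rv_noise t).
pose B sg := [set w | c <= sg * noise t w].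
have mB sg : measurable (B sg).
  by apply: (finite_rv_preimage sM [set v | c <= sg * v] fN).
apply: (@le_trans _ _ (fine (P (B 1 `|` B (-1))))).
  apply: fine_P_mono.
  - exact: (finite_rv_preimage sM [set v : R | c < `|v|] fN).
  - exact: measurableU.
  - move=> w /=; rewrite /B /= mul1r mulN1r ltr_normr.
    by move=> /orP[/ltW ?|/ltW ?]; [left|right].
apply: le_trans (fine_P_setU_le _ (mB _) (mB _)) _.
rewrite mulr2n mulrDl !mul1r.
by apply: lerD; apply: noise_one_sided_tail; rewrite ?expr1n// sqrrN expr1n.
Qed.

Lemma expRN_le_inv4 (u : R) : 0 < u -> expR (- u) <= 24 / u ^+ 4.
Proof.
move=> u0; rewrite expRN -[24 / _]invrK lef_pV2 ?posrE ?expR_gt0//; last first.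
  by rewrite invr_gt0 divr_gt0// exprn_gt0.
rewrite invf_div; apply: le_trans (expR_ge1Dxn 3 (ltW u0)).
by rewrite lerDr.
Qed.

Definition noise_tail_cst (c : R) : R := 2 * (24 * 2 ^+ 4) / c ^+ 8.

Lemma noise_tail_cst_ge0 (c : R) : 0 < c -> 0 <= noise_tail_cst c.
Proof. by move=> c0; rewrite divr_ge0 ?mulr_ge0 ?exprn_ge0 ?(ltW c0). Qed.

Lemma noise_tail_poly (c : R) t : 0 < c -> (0 < t)%N ->
  fine (P [set w | c < `|noise t w|]) <= noise_tail_cst c / t%:R ^+ 4.
Proof.
move=> c0 t0; apply: le_trans (noise_tail c0 t0) _.
have tR : 0 < t%:R :> R by rewrite ltr0n.
have u0 : 0 < c ^+ 2 * t%:R / 2 by rewrite divr_gt0// mulr_gt0// exprn_gt0.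
apply: (@le_trans _ _ (2 * (24 / (c ^+ 2 * t%:R / 2) ^+ 4))).
  by rewrite ler_pM2l// expRN_le_inv4.
rewrite /noise_tail_cst le_eqVlt; apply/orP; left; apply/eqP; field.
by rewrite !gt_eqF.
Qed.

End Azuma.

(** * Summing tail probabilities *)

Section TailSum.
Context {d : measure_display} {Omega : measurableType d} {R : realType}.
Variable P : probability Omega R.

(** Lets a tail of the series of inverse fourth powers be summed in closed
    form. *)
Lemma inv_quartic_telescope (s : nat) : (0 < s)%N ->
  1 / s%:R ^+ 4 <= 2 / s%:R ^+ 3 - 2 / s.+1%:R ^+ 3 :> R.
Proof.
move=> s0; have sR : 1 <= s%:R :> R by rewrite ler1n.
rewrite -[s.+1%:R]natr1; move: (s%:R) sR => u u1.
have u0 : 0 < u by lra.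
have v0 : 0 < u + 1 by lra.
rewrite -subr_ge0.
have -> : 2 / u ^+ 3 - 2 / (u + 1) ^+ 3 - 1 / u ^+ 4
  = (2 * u * (3 * u ^+ 2 + 3 * u + 1) - (u + 1) ^+ 3) / (u ^+ 4 * (u + 1) ^+ 3).
  by field; rewrite !gt_eqF.
rewrite divr_ge0 ?mulr_ge0 ?exprn_ge0 ?(ltW u0) ?(ltW v0)//.
have -> : 2 * u * (3 * u ^+ 2 + 3 * u + 1) - (u + 1) ^+ 3
  = (5 * u ^+ 2 * (u - 1) + 8 * u * (u - 1) + 7 * (u - 1) + 6) by ring.
have w0 : 0 <= u - 1 by lra.
by rewrite !addr_ge0// !mulr_ge0// ?exprn_ge0// ltW.
Qed.

Lemma tail_union_bound (B : nat -> set Omega) (K : R) (tau : nat) : 0 <= K ->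
  (0 < tau)%N -> (forall s, measurable (B s)) ->
  (forall s, (0 < s)%N -> fine (P (B s)) <= K / s%:R ^+ 4) ->
  fine (P (\bigcup_k B (tau + k)%N)) <= 2 * K / tau%:R ^+ 3.
Proof.
move=> K0 tau0 mB BK; apply: fine_P_bigcup_le => // N.
apply: (@le_trans _ _ (\sum_(0 <= k < N) K * (2 / (tau + k)%:R ^+ 3
    - 2 / (tau + k).+1%:R ^+ 3))).
  apply: ler_sum => k _; have tk : (0 < tau + k)%N by rewrite addn_gt0 tau0.
  apply: le_trans (BK _ tk) _; rewrite ler_wpM2l// -[X in X <= _]mul1r.
  exact: inv_quartic_telescope.
pose f k : R := - (2 / (tau + k)%:R ^+ 3).
rewrite -mulr_sumr (eq_bigr (fun k => f k.+1 - f k)) => [|k _]; last first.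
  by rewrite /f opprK addrC addnS.
rewrite telescope_sumr// /f addn0 opprK addrC.
rewrite [2 * K]mulrC -mulrA ler_wpM2l// gerBl divr_ge0// exprn_ge0//.
Qed.

End TailSum.

(** * Adaptedness of the sampled process *)

Section Adapted.
Context {R : realType} {d : measure_display} {Omega : measurableType d}.

(** The sampled action is not a generator of the history, but it can be read
    off two consecutive iterates because the step size is nonzero. *)
Lemma finite_rv_action (F : set (set Omega)) (k : nat) (u u' : Omega -> 'cV[R]_k)
    (i : Omega -> 'I_k) (a : R) :
  sigma_algebra setT F -> a != 0 -> finite_rv F u ->
  (forall w, u' w = (1 - a) *: u w + a *: stdvec (i w)) ->
  (forall l B, measurable B -> F ((fun w => u' w l 0) @^-1` B)) ->
  finite_rv F i.
Proof.
move=> sF a0 [T [H [phi [FH uE]]]] u'E Fu'.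
exists (T * 'I_k)%type, (fun w => (H w, i w)), snd; split=> // -[h l].
have -> : (fun w => (H w, i w)) @^-1` [set (h, l)]
    = H @^-1` [set h] `&` (fun w => u' w l 0) @^-1` [set (1 - a) * phi h l 0 + a].
  apply/seteqP; split=> w /= [hw].
    by move=> iw; rewrite hw u'E uE hw iw !mxE eqxx mulr1.
  rewrite u'E uE hw !mxE => /addrI; case: eqVneq => [->//|_ /=].
  by rewrite mulr0 => /esym/eqP; rewrite (negbTE a0).
by apply: sigmaI => //; exact: Fu'.
Qed.

Variable P : probability Omega R.
Context {m n : nat}.
Variables (A : 'M[R]_(m, n)) (eta : R) (alpha : nat -> R) (i0 : 'I_n) (j0 : 'I_m).
Variables (I : nat -> Omega -> 'I_n) (J : nat -> Omega -> 'I_m).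
Variables (x : nat -> Omega -> 'cV[R]_n) (y : nat -> Omega -> 'cV[R]_m).
Hypothesis lfp : is_lfp P x y A eta alpha i0 j0 I J.

Local Notation F := (history x y).

Lemma history_sigma_algebra t : sigma_algebra setT (F t).
Proof. exact: smallest_sigma_algebra. Qed.

Lemma history_mono s t : (s <= t)%N -> F s `<=` F t.
Proof.
move=> st; apply: sub_sigma_algebra2 => B [k /= ks kB]; exists k => //=.
exact: leq_trans st.
Qed.

Lemma history_x t k i (B : set R) : (k <= t)%N -> measurable B ->
  F t ((fun w => x k w i 0) @^-1` B).
Proof.
move=> kt mB; apply: sub_sigma_algebra; exists k => //=; left; exists i => //.
by exists B => //; rewrite setTI.
Qed.

Lemma history_y t k j (B : set R) : (k <= t)%N -> measurable B ->
  F t ((fun w => y k w j 0) @^-1` B).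
Proof.
move=> kt mB; apply: sub_sigma_algebra; exists k => //=; right; exists j => //.
by exists B => //; rewrite setTI.
Qed.

Let a_neq0 t : alpha t != 0.
Proof. by have /andP[/gt_eqF ->] := lfp_step lfp t. Qed.

Lemma lfp_finite_rv t : finite_rv measurable (x t) /\ finite_rv measurable (y t).
Proof.
have sM := @sigma_measurable d Omega.
elim: t => [|t [IHx IHy]]; split.
- rewrite (_ : x 0 = fun=> stdvec i0); last exact/funext/(lfp_x0 lfp).
  exact: finite_rv_cst.
- rewrite (_ : y 0 = fun=> stdvec j0); last exact/funext/(lfp_y0 lfp).
  exact: finite_rv_cst.
- rewrite (_ : x t.+1 = fun w =>
    (1 - alpha t) *: x t w + alpha t *: stdvec (I t.+1 w)); last first.
    exact/funext/(lfp_xS lfp).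
  apply: (finite_rv_op sM (fun u i => (1 - alpha t) *: u + alpha t *: stdvec i)) => //.
  by exists 'I_n, (I t.+1), id; split=> // i; exact: (lfp_measI lfp).
- rewrite (_ : y t.+1 = fun w =>
    (1 - alpha t) *: y t w + alpha t *: stdvec (J t.+1 w)); last first.
    exact/funext/(lfp_yS lfp).
  apply: (finite_rv_op sM (fun u i => (1 - alpha t) *: u + alpha t *: stdvec i)) => //.
  by exists 'I_m, (J t.+1), id; split=> // j; exact: (lfp_measJ lfp).
Qed.

(** The history is generated by the iterates, which are built from the
    measurable action events. *)
Lemma history_measurable t : F t `<=` measurable.
Proof.
have sM := @sigma_measurable d Omega.
apply: smallest_sub => //= _ [k _ [[l _ [B mB <-]]|[l _ [B mB <-]]]]; rewrite setTI.
- exact: (finite_rv_preimage sM [set v : 'cV[R]_n | B (v l 0)] (proj1 (lfp_finite_rv k))).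
- exact: (finite_rv_preimage sM [set v : 'cV[R]_m | B (v l 0)] (proj2 (lfp_finite_rv k))).
Qed.

Lemma lfp_adapted t k : (k <= t)%N -> finite_rv (F t) (x k) /\ finite_rv (F t) (y k).
Proof.
have sF := history_sigma_algebra t.
elim: k => [_|k IH kt]; [split|].
- rewrite (_ : x 0 = fun=> stdvec i0); last exact/funext/(lfp_x0 lfp).
  exact: finite_rv_cst.
- rewrite (_ : y 0 = fun=> stdvec j0); last exact/funext/(lfp_y0 lfp).
  exact: finite_rv_cst.
have [Fx Fy] := IH (ltnW kt).
have FI : finite_rv (F t) (I k.+1).
  apply: (finite_rv_action sF (a_neq0 k) Fx (lfp_xS lfp k)) => l B mB.
  exact: history_x.
have FJ : finite_rv (F t) (J k.+1).
  apply: (finite_rv_action sF (a_neq0 k) Fy (lfp_yS lfp k)) => l B mB.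
  exact: history_y.
split.
- rewrite (_ : x k.+1 = fun w =>
    (1 - alpha k) *: x k w + alpha k *: stdvec (I k.+1 w)); last first.
    exact/funext/(lfp_xS lfp).
  exact: (finite_rv_op sF (fun u i => (1 - alpha k) *: u + alpha k *: stdvec i)).
- rewrite (_ : y k.+1 = fun w =>
    (1 - alpha k) *: y k w + alpha k *: stdvec (J k.+1 w)); last first.
    exact/funext/(lfp_yS lfp).
  exact: (finite_rv_op sF (fun u i => (1 - alpha k) *: u + alpha k *: stdvec i)).
Qed.

Lemma history_I t i : F t.+1 (I t.+1 @^-1` [set i]).
Proof.
have sF := history_sigma_algebra t.+1.
have FI : finite_rv (F t.+1) (I t.+1).
  apply: (finite_rv_action sF (a_neq0 t) (proj1 (lfp_adapted (leqnSn t)))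
    (lfp_xS lfp t)) => l B mB.
  exact: history_x.
exact: (finite_rv_preimage sF _ FI).
Qed.

Lemma history_J t j : F t.+1 (J t.+1 @^-1` [set j]).
Proof.
have sF := history_sigma_algebra t.+1.
have FJ : finite_rv (F t.+1) (J t.+1).
  apply: (finite_rv_action sF (a_neq0 t) (proj2 (lfp_adapted (leqnSn t)))
    (lfp_yS lfp t)) => l B mB.
  exact: history_y.
exact: (finite_rv_preimage sF _ FJ).
Qed.

Lemma lfp_simplex t w : simplex n (x t w) /\ simplex m (y t w).
Proof.
elim: t => [|t [IHx IHy]].
  rewrite (lfp_x0 lfp) (lfp_y0 lfp); split; exact: simplex_stdvec.
have a01 : 0 <= alpha t <= 1.
  by have /andP[/ltW -> ->] := lfp_step lfp t.
rewrite (lfp_xS lfp) (lfp_yS lfp).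
by split; apply: simplex_convex => //; exact: simplex_stdvec.
Qed.

End Adapted.

(** * Tail of the last exit time *)

Section EscapeTail.
Context {R : realType} {d : measure_display} {Omega : measurableType d}.
Variable P : probability Omega R.
Context {m n : nat}.
Variables (A : 'M[R]_(m, n)) (eta : R) (i0 : 'I_n) (j0 : 'I_m).
Variables (I : nat -> Omega -> 'I_n) (J : nat -> Omega -> 'I_m).
Variables (x : nat -> Omega -> 'cV[R]_n) (y : nat -> Omega -> 'cV[R]_m).
Local Notation step t := (2 / (t%:R + 2) : R).
Hypothesis eta0 : 0 < eta.
Hypothesis lfp : is_lfp P x y A eta (fun t => step t) i0 j0 I J.
Variables (xs : 'cV[R]_n) (ys : 'cV[R]_m).
Hypothesis fp : fixed_point A eta xs ys.

Let n0 : (0 < n)%N := leq_ltn_trans (leq0n i0) (ltn_ord i0).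
Let m0 : (0 < m)%N := leq_ltn_trans (leq0n j0) (ltn_ord j0).
Let sM := @sigma_measurable d Omega.

(** The predictable companion of the process: each sampled vertex is replaced
    by its conditional expectation. *)
Fixpoint mean_x t (w : Omega) : 'cV[R]_n :=
  if t is s.+1 then (1 - step s) *: mean_x s w + step s *: logit_x A eta (y s w)
  else x 0 w.
Fixpoint mean_y t (w : Omega) : 'cV[R]_m :=
  if t is s.+1 then (1 - step s) *: mean_y s w + step s *: logit_y A eta (x s w)
  else y 0 w.

Definition noise_x (i : 'I_n) := noise (fun t => I t.+1 @^-1` [set i])
  (fun t w => logit_x A eta (y t w) i 0).
Definition noise_y (j : 'I_m) := noise (fun t => J t.+1 @^-1` [set j])
  (fun t w => logit_y A eta (x t w) j 0).

(** Solution of the averaging recursion with step sizes 2/(t+2); at t = 0 the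
    quotient is 0/0 = 0. *)
Lemma averaged_recursion (u e : nat -> R) : u 0 = 0 ->
  (forall t, u t.+1 = (1 - step t) * u t + step t * e t) ->
  forall t, u t = (\sum_(s < t) 2 * (s%:R + 1) * e s) / (t%:R * (t%:R + 1)).
Proof.
move=> u0 uS; elim=> [|t IH]; first by rewrite big_ord0 mul0r.
rewrite uS IH big_ord_recr/= -[t.+1%:R]natr1.
set S := \sum_(_ < _) _.
have t0 : 0 <= t%:R :> R by rewrite ler0n.
have [t00|tn0] := eqVneq (t%:R : R) 0.
  have S0 : S = 0.
    rewrite /S; move/eqP: t00; rewrite pnatr_eq0 => /eqP ->.
    by rewrite big_ord0.
  by rewrite t00 S0 !mul0r mulr0 !add0r; field.
by field; rewrite tn0/= !gt_eqF//; lra.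
Qed.

Lemma stdvecE k (i l : 'I_k) (T : Type) (f : T -> 'I_k) w : f w = l ->
  @stdvec R k l i 0 = \1_(f @^-1` [set i]) w :> R.
Proof.
move=> fw; rewrite mxE andbT indicE; congr (_%:R).
congr nat_of_bool; apply/eqP/idP => [->|/set_mem/= <-//].
by apply/mem_set => /=.
Qed.

Lemma mean_x_noise t w i : x t w i 0 - mean_x t w i 0 = noise_x i t w.
Proof.
apply: (@averaged_recursion (fun t => x t w i 0 - mean_x t w i 0)
  (fun s => increment (fun t => I t.+1 @^-1` [set i])
   (fun t w => logit_x A eta (y t w) i 0) s w)).
  by rewrite subrr.
move=> s; rewrite (lfp_xS lfp)/= /increment -(stdvecE i (erefl (I s.+1 w))).
rewrite !mxE; ring.
Qed.

Lemma mean_y_noise t w j : y t w j 0 - mean_y t w j 0 = noise_y j t w.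
Proof.
apply: (@averaged_recursion (fun t => y t w j 0 - mean_y t w j 0)
  (fun s => increment (fun t => J t.+1 @^-1` [set j])
   (fun t w => logit_y A eta (x t w) j 0) s w)).
  by rewrite subrr.
move=> s; rewrite (lfp_yS lfp)/= /increment -(stdvecE j (erefl (J s.+1 w))).
rewrite !mxE; ring.
Qed.

Lemma finite_rv_logit_x t i :
  finite_rv (history x y t) (fun w => logit_x A eta (y t w) i 0).
Proof.
exact: (finite_rv_comp (fun v => logit_x A eta v i 0)
  (proj2 (lfp_adapted lfp (leqnn t)))).
Qed.

Lemma finite_rv_logit_y t j :
  finite_rv (history x y t) (fun w => logit_y A eta (x t w) j 0).
Proof.
exact: (finite_rv_comp (fun v => logit_y A eta v j 0)
  (proj1 (lfp_adapted lfp (leqnn t)))).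
Qed.

Lemma noise_x_tail (c : R) i t : 0 < c -> (0 < t)%N ->
  fine (P [set w | c < `|noise_x i t w|]) <= noise_tail_cst c / t%:R ^+ 4.
Proof.
apply: (noise_tail_poly (history_sigma_algebra x y) (history_measurable lfp)
  (@history_mono _ _ _ _ _ x y)).
- by move=> s; exact: (history_I lfp).
- by move=> s; exact: (lfp_condI lfp).
- by move=> s; exact: finite_rv_logit_x.
Qed.

Lemma noise_y_tail (c : R) j t : 0 < c -> (0 < t)%N ->
  fine (P [set w | c < `|noise_y j t w|]) <= noise_tail_cst c / t%:R ^+ 4.
Proof.
apply: (noise_tail_poly (history_sigma_algebra x y) (history_measurable lfp)
  (@history_mono _ _ _ _ _ x y)).
- by move=> s; exact: (history_J lfp).
- by move=> s; exact: (lfp_condJ lfp).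
- by move=> s; exact: finite_rv_logit_y.
Qed.

Definition both_close (r : R) t (w : Omega) : Prop :=
  coord_close r (x t w) xs /\ coord_close r (y t w) ys.

Definition stays_close (r : R) t : set Omega :=
  [set w | forall s, (t <= s)%N -> both_close r s w].

Lemma measurable_coord (B : set ('cV[R]_n * 'cV[R]_m)) t :
  measurable [set w | B (x t w, y t w)].
Proof.
have [fx fy] := lfp_finite_rv lfp t.
exact: (finite_rv_preimage sM B (finite_rv_pair sM fx fy)).
Qed.

Lemma measurable_stay (B : set ('cV[R]_n * 'cV[R]_m)) t :
  measurable (stay_event x y B t).
Proof.
have -> : stay_event x y B t = \bigcap_k [set w | B (x (t + k)%N w, y (t + k)%N w)].
  apply/seteqP; split=> w /= h.
    by move=> k _ /=; apply: h; rewrite leq_addr.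
  by move=> s ts; have := h (s - t)%N Logic.I; rewrite /= subnKC.
by apply: bigcap_measurableType => k _; exact: measurable_coord.
Qed.

Lemma stays_closeE r t : stays_close r t =
  stay_event x y [set p | coord_close r p.1 xs /\ coord_close r p.2 ys] t.
Proof. by []. Qed.

(** If the process leaves the r-neighbourhood after time t, then by
    [mean_tracking] some noise coordinate exceeds c after time t / k; these
    events have probabilities summable well enough to leave a cubic decay.
    The cubic rate is what later makes the weighted escape probabilities
    summable. *)
Lemma escape_tail (r : R) : 0 < r -> exists2 K : R, 0 <= K &
  forall t, (0 < t)%N -> fine (P (~` stays_close r t)) <= K / t%:R ^+ 3.
Proof.
move=> r0.
have [c [k [c0 k0 track]]] := mean_tracking eta0 n0 m0 fp r0.
pose bad_x s i := [set w | c < `|noise_x i s w|].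
pose bad_y s j := [set w | c < `|noise_y j s w|].
pose bad s := (\bigcup_(i in [set: 'I_n]) bad_x s i) `|` (\bigcup_(j in [set: 'I_m]) bad_y s j).
have mbad_x s i : measurable (bad_x s i).
  apply: (history_measurable lfp (t:=s)).
  apply: (finite_rv_preimage (history_sigma_algebra x y s) [set v : R | c < `|v|]).
  apply: (finite_rv_noise (history_sigma_algebra x y)
    (@history_mono _ _ _ _ _ x y)) => s'; first exact: (history_I lfp).
  exact: finite_rv_logit_x.
have mbad_y s j : measurable (bad_y s j).
  apply: (history_measurable lfp (t:=s)).
  apply: (finite_rv_preimage (history_sigma_algebra x y s) [set v : R | c < `|v|]).
  apply: (finite_rv_noise (history_sigma_algebra x y)
    (@history_mono _ _ _ _ _ x y)) => s'; first exact: (history_J lfp).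
  exact: finite_rv_logit_y.
have mbad s : measurable (bad s).
  by apply: measurableU; apply: fin_bigcup_measurable.
pose K1 := (n%:R + m%:R) * (noise_tail_cst c).
have K10 : 0 <= K1 by rewrite mulr_ge0 ?addr_ge0// noise_tail_cst_ge0.
have badP s : (0 < s)%N -> fine (P (bad s)) <= K1 / s%:R ^+ 4.
  move=> s0; apply: le_trans (fine_P_setU_le _ _ _) _.
  - exact: fin_bigcup_measurable.
  - exact: fin_bigcup_measurable.
  rewrite /K1 -mulrA mulrDl; apply: lerD;
    apply: (le_trans (fine_P_fin_bigcup_le _ _)) => //.
  - apply: (@le_trans _ _ (\sum_(i < n) noise_tail_cst c / s%:R ^+ 4)).
      by apply: ler_sum => i _; exact: noise_x_tail.
    by rewrite sumr_const card_ord -[_ *+ n]mulr_natl.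
  - apply: (@le_trans _ _ (\sum_(i < m) noise_tail_cst c / s%:R ^+ 4)).
      by apply: ler_sum => j _; exact: noise_y_tail.
    by rewrite sumr_const card_ord -[_ *+ m]mulr_natl.
have mstay t : measurable (stays_close r t).
  by rewrite stays_closeE; exact: measurable_stay.
have kR : 0 < k%:R :> R by rewrite ltr0n.
exists ((16 * K1 + 1) * k%:R ^+ 3).
  by rewrite mulr_ge0 ?exprn_ge0// addr_ge0// mulr_ge0.
move=> t t0; have tR : 0 < t%:R :> R by rewrite ltr0n.
have [tk|kt] := ltnP t k.
  apply: le_trans (fine_P_le1 _ (measurableC (mstay t))) _.
  rewrite ler_pdivlMr ?exprn_gt0// mul1r mulrDl mul1r.
  apply: (@le_trans _ _ (k%:R ^+ 3)); last first.
    by rewrite lerDr mulr_ge0 ?exprn_ge0// mulr_ge0.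
  by rewrite lerXn2r ?nnegrE ?ler_nat// ltnW.
set tau := (t %/ k)%N.
have tau0 : (0 < tau)%N by rewrite divn_gt0.
have incl : ~` stays_close r t `<=` \bigcup_q bad (tau + q)%N.
  rewrite -[X in _ `<=` X]setCK; apply: subsetC => w nbad s ts.
  have := track (x^~ w) (mean_x^~ w) (y^~ w) (mean_y^~ w) tau
    (fun s => proj1 (lfp_simplex lfp s w)) (fun s => proj2 (lfp_simplex lfp s w))
    (proj1 (lfp_simplex lfp 0 w)) (proj2 (lfp_simplex lfp 0 w))
    (fun=> erefl) (fun=> erefl) tau0.
  apply; last by apply: leq_trans ts; rewrite mulnC leq_divM.
  move=> q tauq; split=> l.
  - rewrite leNgt; apply/negP => ll; apply: nbad; exists (q - tau)%N => //.
    by rewrite subnKC//; left; exists l => //; rewrite /bad_x/= -mean_x_noise.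
  - rewrite leNgt; apply/negP => ll; apply: nbad; exists (q - tau)%N => //.
    by rewrite subnKC//; right; exists l => //; rewrite /bad_y/= -mean_y_noise.
have mU : measurable (\bigcup_q bad (tau + q)%N) by exact: bigcup_measurable.
apply: le_trans (fine_P_mono P (measurableC (mstay t)) mU incl) _.
apply: le_trans (tail_union_bound K10 tau0 mbad badP) _.
have tauR : 0 < tau%:R :> R by rewrite ltr0n.
have t2 : t%:R <= 2 * k%:R * tau%:R :> R.
  rewrite -!natrM ler_nat; apply: (@leq_trans (k * tau.+1)).
    by rewrite mulnC ltnW// ltn_ceil.
  by rewrite (mulnC 2) -mulnA leq_pmul2l// mul2n -addnn -addn1 leq_add2l.
have t3 : t%:R ^+ 3 <= (2 * k%:R * tau%:R) ^+ 3 :> R.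
  by rewrite lerXn2r ?nnegrE ?mulr_ge0.
rewrite ler_pdivlMr ?exprn_gt0// mulrAC ler_pdivrMr ?exprn_gt0//.
apply: (@le_trans _ _ (2 * K1 * (2 * k%:R * tau%:R) ^+ 3)).
  by rewrite ler_wpM2l// mulr_ge0.
have -> : 2 * K1 * (2 * k%:R * tau%:R) ^+ 3
  = 16 * K1 * k%:R ^+ 3 * tau%:R ^+ 3 by ring.
rewrite ler_wpM2r ?exprn_ge0// ler_wpM2r ?exprn_ge0// lerDl//.
Qed.

End EscapeTail.

(** * Relative interior of the simplex *)

Section Geometry.
Context {R : realType} {n : nat}.
Implicit Types (p q c : 'cV[R]_n).

Lemma affine_hull_simplex p : \sum_i p i 0 = 1 -> affine_hull (simplex n) p.
Proof.
move=> p1; exists n, (fun i => p i 0), (@stdvec R n); split=> //.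
  by move=> i; exact: simplex_stdvec.
apply/matrixP => i j; rewrite ord1 summxE (bigD1 i)//= big1 ?addr0 => [|k ki].
  by rewrite !mxE eqxx mulr1.
by rewrite !mxE eq_sym (negbTE ki) mulr0.
Qed.

Lemma sum_transfer p (a : R) i j :
  \sum_k (p + a *: (stdvec j - stdvec i)) k 0 = \sum_k p k 0.
Proof.
have s1 l : \sum_k (@stdvec R n l) k 0 = 1 by have [] := @simplex_stdvec R n l.
transitivity (\sum_k (p k 0 + a * (@stdvec R n j k 0 - @stdvec R n i k 0))).
  by apply: eq_bigr => k _; rewrite !mxE.
by rewrite big_split/= -mulr_sumr sumrB !s1 subrr mulr0 addr0.
Qed.

Lemma coord_transfer p (a : R) i j : j != i ->
  (p + a *: (stdvec j - stdvec i)) i 0 = p i 0 - a.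
Proof.
by move=> ji; rewrite !mxE !eqxx [i == j]eq_sym (negbTE ji) /= sub0r mulrN mulr1.
Qed.

(** At a vanishing coordinate i, moving a little mass from i to a charged
    coordinate j stays in the affine hull but leaves the simplex. *)
Lemma relint_gt0 p : relint (simplex n) p -> forall i, 0 < p i 0.
Proof.
move=> [[p0 p1] pn] i; rewrite lt_neqAle p0 andbT eq_sym.
apply/negP => /eqP pi0.
have [j pj] : exists j, p j 0 != 0.
  apply/existsP; rewrite -negb_forall; apply/negP => /forallP all0.
  move: p1; rewrite big1 => [/eqP|k _]; first by rewrite eq_sym oner_eq0.
  exact/eqP/all0.
have ji : j != i by apply: contra pj => /eqP ->; rewrite pi0.
move: pn => /nbhs_ballP [e /= e0 eP].
pose v : 'cV[R]_n := stdvec j - stdvec i.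
pose a := e / 2 / (`|v| + 1).
have v1 : 0 < `|v| + 1 by rewrite ltr_wpDl.
have a0 : 0 < a by rewrite divr_gt0// divr_gt0.
have : simplex n (p + a *: v).
  apply: eP; last by apply: affine_hull_simplex; rewrite sum_transfer.
  rewrite -ball_normE/= opprD addNKr normrN normrZ gtr0_norm//.
  rewrite /a mulrAC ltr_pdivrMr//; apply: (@lt_le_trans _ _ (e * (`|v| + 1))).
    rewrite -mulrA ltr_pM2l// ltr_pdivrMl// mulrDr mulr1.
    by have := normr_ge0 v; lra.
  by [].
move=> [/(_ i) + _]; rewrite coord_transfer// pi0 sub0r oppr_ge0.
by rewrite leNgt a0.
Qed.

(** A coordinate is balanced by all the others, so it carries at most half of
    the l1 norm. *)
Lemma sum0_coord_half (u : 'cV[R]_n) i : \sum_k u k 0 = 0 ->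
  2 * `|u i 0| <= l1norm u.
Proof.
move=> u0; rewrite mulr2n mulrDl mul1r /l1norm (bigD1 i)//= lerD2l.
have -> : `|u i 0| = `|\sum_(k | k != i) u k 0|.
  move: u0; rewrite (bigD1 i)//= => /eqP; rewrite addr_eq0 => /eqP ->.
  by rewrite normrN.
exact: ler_norm_sum.
Qed.

(** Uniform positivity on the ball, without compactness: if the centre had a
    coordinate at most r/2, shifting that mass elsewhere would remain in the
    ball and hit the boundary; hence coordinates are at least c i - r/2.  In
    dimension one the only coordinate equals 1. *)
Lemma l1ball_coord_lb c (r : R) : 0 < r -> simplex n c ->
  (forall p, l1ball c r p -> relint (simplex n) p) ->
  exists2 e : R, 0 < e & forall p, l1ball c r p -> forall i, e <= p i 0.
Proof.
move=> r0 cs hN.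
have c0 i : 0 <= c i 0 by exact: simplex_ge0.
have big i j : j != i -> r / 2 < c i 0.
  move=> ji; rewrite ltNge; apply/negP => small.
  have : l1ball c r (c + c i 0 *: (stdvec j - stdvec i)).
    split; first by rewrite sum_transfer; case: cs.
    rewrite addrC addKr l1normZ ger0_norm//.
    have := l1norm_simplexB (@simplex_stdvec R n j) (@simplex_stdvec R n i).
    move=> /(ler_wpM2l (c0 i)) /le_trans; apply.
    by rewrite -ler_pdivlMr.
  by move=> /hN /relint_gt0 /(_ i); rewrite coord_transfer// subrr ltxx.
pose f i := if [exists j, j != i] then c i 0 - r / 2 else 1.
exists (\big[Num.min/1]_i f i).
  apply: lt_bigmin => // i _; rewrite /f; case: ifP => // /existsP[j ji].
  by rewrite subr_gt0 (big i j).
move=> p [p1 pr] i; apply: (@le_trans _ _ (f i)); first exact: bigmin_le.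
rewrite /f; case: ifPn => [_|/existsPn noj].
  have : 2 * `|(p - c) i 0| <= r.
    apply: le_trans pr; apply: sum0_coord_half.
    under eq_bigr do rewrite !mxE.
    by rewrite sumrB p1; case: cs => _ ->; rewrite subrr.
  rewrite !mxE -ler_pdivlMl// mulrC ler_norml => /andP[+ _]; rewrite lerBrDr.
  by rewrite addrC.
rewrite -p1 (bigD1 i)//= big1 ?addr0// => k ki.
by have := noj k; rewrite ki.
Qed.

Lemma dot_abs_bound (g u : 'cV[R]_n) (G : R) : (forall i, `|g i 0| <= G) ->
  `|dot g u| <= G * l1norm u.
Proof.
move=> gG; apply: le_trans (ler_norm_sum _ _ _) _; rewrite mulr_sumr.
by apply: ler_sum => i _; rewrite normrM ler_wpM2r.
Qed.

End Geometry.

(** * The gap near the fixed point *)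

Section FixedPoint.
Context {R : realType} {m n : nat}.
Variables (A : 'M[R]_(m, n)) (eta : R).
Hypotheses (eta0 : 0 < eta) (n0 : (0 < n)%N) (m0 : (0 < m)%N).
Variables (xs : 'cV[R]_n) (ys : 'cV[R]_m).
Hypothesis fp : fixed_point A eta xs ys.
Local Notation gap := (duality_gap A eta).
Local Notation kappa := (norm_1oo A ^+ 2 / eta ^+ 2).

Lemma gap_fixed_point : gap xs ys = 0.
Proof.
case: fp; rewrite logit_xE// logit_yE// => xsE ysE.
rewrite gapE//; have := lse_dual_eq n0 (- (eta^-1 *: (A^T *m ys))).
have := lse_dual_eq m0 (eta^-1 *: (A *m xs)).
rewrite xsE ysE => <- <-; rewrite dotNl !dotZl (dot_mulmx A xs ys).
by ring.
Qed.

(** At the fixed point the gradient is constant across coordinates, because the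
    logarithm of softmax cancels the linear part; directions tangent to the
    simplex do not see it. *)
Lemma gap_grad_x_fixed_point (x : 'cV[R]_n) : \sum_i x i 0 = 1 ->
  dot (gap_grad_x A eta xs) (x - xs) = 0.
Proof.
move=> x1; case: fp => xsE ysE.
apply: (@dot_sub_const R n _ (1 - lse (- (eta^-1 *: (A^T *m ys))))).
  by rewrite -xsE x1; case: (logit_x_simplex A eta0 n0 ys).
move=> i; rewrite /gap_grad_x ysE mxE [dnegent _ _ _]mxE -[in ln _]xsE logit_xE//.
by rewrite ln_softmax// [(- _ : 'cV_n) i 0]mxE; ring.
Qed.

Lemma gap_grad_y_fixed_point (y : 'cV[R]_m) : \sum_j y j 0 = 1 ->
  dot (gap_grad_y A eta ys) (y - ys) = 0.
Proof.
move=> y1; case: fp => xsE ysE.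
apply: (@dot_sub_const R m _ (1 - lse (eta^-1 *: (A *m xs)))).
  by rewrite -ysE y1; case: (logit_y_simplex A eta0 m0 xs).
move=> j; rewrite /gap_grad_y xsE mxE [dnegent _ _ _]mxE -[in ln _]ysE logit_yE//.
by rewrite ln_softmax// [(- _ : 'cV_m) j 0]mxE; ring.
Qed.

Lemma gap_quadratic (x : 'cV[R]_n) (y : 'cV[R]_m) (Lx Ly : R) :
  \sum_i x i 0 = 1 -> \sum_j y j 0 = 1 ->
  negent x <= negent xs + dot (dnegent xs) (x - xs) + Lx / 2 * l1norm (x - xs) ^+ 2 ->
  negent y <= negent ys + dot (dnegent ys) (y - ys) + Ly / 2 * l1norm (y - ys) ^+ 2 ->
  gap x y <= eta / 2 * ((Lx + kappa) * l1norm (x - xs) ^+ 2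
                 + (Ly + kappa) * l1norm (y - ys) ^+ 2).
Proof.
move=> x1 y1 hx hy; have := gap_descent A eta0 n0 m0 hx hy.
rewrite gap_fixed_point gap_grad_x_fixed_point// gap_grad_y_fixed_point//.
by rewrite addr0 mulr0 !add0r.
Qed.

End FixedPoint.

Section SmoothOn.
Context {R : realType} {n : nat}.

Lemma smooth_on_negent (B : set 'cV[R]_n) (L : R) x x' :
  smooth_on negent B L -> B x -> B x' -> (forall i, 0 < x i 0) ->
  negent x' <= negent x + dot (dnegent x) (x' - x) + L / 2 * l1norm (x' - x) ^+ 2.
Proof. by move=> sm Bx Bx' x0; rewrite -gradient_negent//; exact: sm. Qed.

End SmoothOn.

(** * Conditioning on the future of the process *)

Section Conditioning.
Context {R : realType} {d : measure_display} {Omega : measurableType d}.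
Variable P : probability Omega R.
Context {m n : nat}.
Variables (A : 'M[R]_(m, n)) (eta : R) (i0 : 'I_n) (j0 : 'I_m).
Variables (I : nat -> Omega -> 'I_n) (J : nat -> Omega -> 'I_m).
Variables (x : nat -> Omega -> 'cV[R]_n) (y : nat -> Omega -> 'cV[R]_m).
Local Notation step t := (2 / (t%:R + 2) : R).
Hypothesis eta0 : 0 < eta.
Hypothesis lfp : is_lfp P x y A eta (fun t => step t) i0 j0 I J.
Variables (xs : 'cV[R]_n) (ys : 'cV[R]_m) (rx ry Lx Ly : R).
Hypothesis fp : fixed_point A eta xs ys.
Hypotheses (hrx : 0 < rx) (hry : 0 < ry).
Hypothesis hN : nbhd xs ys rx ry `<=` relint (simplex n) `*` relint (simplex m).
Hypotheses (Lx0 : 0 <= Lx) (Ly0 : 0 <= Ly).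
Hypotheses (hLx : smooth_on negent (l1ball xs rx) Lx)
  (hLy : smooth_on negent (l1ball ys ry) Ly).

Let n0 : (0 < n)%N := leq_ltn_trans (leq0n i0) (ltn_ord i0).
Let m0 : (0 < m)%N := leq_ltn_trans (leq0n j0) (ltn_ord j0).
Let sM := @sigma_measurable d Omega.
Local Notation N := (nbhd xs ys rx ry).
Local Notation stay := (stay_event x y N).
Local Notation F := (history x y).
Local Notation kappa := (norm_1oo A ^+ 2 / eta ^+ 2).
Local Notation gmax := (duality_gap_max A eta).
Local Notation C := (2 * eta * (Lx + Ly + 2 * kappa)).

Definition gap_at t w : R := duality_gap A eta (x t w) (y t w).

(** The linear term of [gap_step] at the sampled vertices: a martingale
    difference. *)
Definition gap_noise t w : R :=
  eta * (dot (gap_grad_x A eta (x t w)) (stdvec (I t.+1 w) - logit_x A eta (y t w))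
       + dot (gap_grad_y A eta (y t w)) (stdvec (J t.+1 w) - logit_y A eta (x t w))).

Lemma colB k (u v : 'cV[R]_k) i : (u - v) i 0 = u i 0 - v i 0.
Proof. by rewrite !mxE. Qed.

Lemma nbhd_xs_ys : simplex n xs /\ simplex m ys.
Proof.
case: fp => <- <-.
by split; [exact: logit_x_simplex | exact: logit_y_simplex].
Qed.

Lemma l1ball_center k (c : 'cV[R]_k) (r : R) : 0 < r -> simplex k c -> l1ball c r c.
Proof.
move=> r0 [_ c1]; split=> //.
rewrite subrr /l1norm big1 ?ltW// => i _.
by rewrite mxE normr0.
Qed.

Lemma l1ball_relint_x p : l1ball xs rx p -> relint (simplex n) p.
Proof.
move=> px; have [] := hN (_ : N (p, ys)) => //; split=> //=.
by apply: l1ball_center => //; case: nbhd_xs_ys.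
Qed.

Lemma l1ball_relint_y p : l1ball ys ry p -> relint (simplex m) p.
Proof.
move=> py; have [] := hN (_ : N (xs, p)) => //; split=> //=.
by apply: l1ball_center => //; case: nbhd_xs_ys.
Qed.

(** Smoothness of the entropies is only available inside the neighbourhood,
    hence the need for both endpoints to lie there. *)
Lemma gap_drift t w : N (x t w, y t w) -> N (x t.+1 w, y t.+1 w) ->
  gap_at t.+1 w <= (1 - step t) * gap_at t w + step t * gap_noise t w
    + C * step t ^+ 2.
Proof.
move=> [/= Bx By] [/= Bx' By']; rewrite /gap_at /gap_noise.
have [sx sy] := lfp_simplex lfp t w.
have x0 := relint_gt0 (l1ball_relint_x Bx); have y0 := relint_gt0 (l1ball_relint_y By).
have := smooth_on_negent hLx Bx Bx' x0; have := smooth_on_negent hLy By By' y0.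
rewrite (lfp_xS lfp) (lfp_yS lfp) => hy hx.
by apply: gap_step hx hy => //;
  [exact: step01|exact: simplex_stdvec|exact: simplex_stdvec].
Qed.

(** Inside the neighbourhood coordinates are bounded below, so the logarithms
    in the gradients are bounded. *)
Lemma gap_noise_bound : exists2 b : R, 0 <= b &
  forall t w, N (x t w, y t w) -> `|gap_noise t w| <= b.
Proof.
have [sxs sys] := nbhd_xs_ys.
have [ex ex0 xlb] := l1ball_coord_lb hrx sxs l1ball_relint_x.
have [ey ey0 ylb] := l1ball_coord_lb hry sys l1ball_relint_y.
pose Gx := payoff_bound A eta + (1 - ln ex).
pose Gy := payoff_bound A eta + (1 - ln ey).
exists (eta * (`|Gx| * 2 + `|Gy| * 2)).
  by rewrite mulr_ge0 ?(ltW eta0)// addr_ge0// mulr_ge0.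
move=> t w [/= Bx By]; have [sx sy] := lfp_simplex lfp t w.
rewrite /gap_noise normrM gtr0_norm// ler_pM2l//.
apply: le_trans (ler_normD _ _) _; apply: lerD.
- apply: le_trans (dot_abs_bound _ (G := `|Gx|) _) _.
    move=> i; apply: le_trans (ler_norm _).
    by apply: gap_grad_x_bound => //; exact: xlb.
  rewrite ler_wpM2l// l1norm_simplexB//; first exact: simplex_stdvec.
  exact: logit_x_simplex.
- apply: le_trans (dot_abs_bound _ (G := `|Gy|) _) _.
    move=> j; apply: le_trans (ler_norm _).
    by apply: gap_grad_y_bound => //; exact: ylb.
  rewrite ler_wpM2l// l1norm_simplexB//; first exact: simplex_stdvec.
  exact: logit_y_simplex.
Qed.

Lemma finite_rv_gap_at t : finite_rv measurable (gap_at t).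
Proof.
have [fx fy] := lfp_finite_rv lfp t.
exact: (finite_rv_op sM (duality_gap A eta)).
Qed.

Lemma finite_rv_gap_noise t : finite_rv measurable (gap_noise t).
Proof.
have [fx fy] := lfp_finite_rv lfp t.
have fI : finite_rv measurable (I t.+1).
  by exists 'I_n, (I t.+1), id; split=> // i; exact: (lfp_measI lfp).
have fJ : finite_rv measurable (J t.+1).
  by exists 'I_m, (J t.+1), id; split=> // j; exact: (lfp_measJ lfp).
exact: (finite_rv_op sM (fun (p : 'cV[R]_n * 'cV[R]_m) (q : 'I_n * 'I_m) =>
  eta * (dot (gap_grad_x A eta p.1) (stdvec q.1 - logit_x A eta p.2)
       + dot (gap_grad_y A eta p.2) (stdvec q.2 - logit_y A eta p.1)))
  (finite_rv_pair sM fx fy) (finite_rv_pair sM fI fJ)).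
Qed.

Lemma finite_rv_mul_indic (B : set Omega) (Z : Omega -> R) : measurable B ->
  finite_rv measurable Z -> finite_rv measurable (fun w => \1_B w * Z w).
Proof.
move=> mB fZ; apply: (finite_rv_op sM *%R _ fZ); exact: finite_rv_indic.
Qed.

Lemma Ex_past_increment t (E : nat -> set Omega) (g : nat -> Omega -> R) Z :
  measurable (E t) -> is_cond_prob P (F t) (E t) (g t) ->
  finite_rv (F t) (g t) -> finite_rv (F t) Z ->
  Ex P (fun w => Z w * increment E g t w) = 0.
Proof.
move=> mE Eg fg fZ; have sF := history_sigma_algebra x y t.
have FM := history_measurable lfp (t:=t).
under [X in Ex _ X]eq_fun do rewrite /increment mulrBr.
rewrite ExB.
- by rewrite (Ex_cond_prob sF FM mE Eg fg fZ) subrr.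
- apply: (finite_rv_op sM *%R (finite_rv_sub FM fZ)).
  exact: finite_rv_indic.
- exact: finite_rv_sub FM (finite_rv_op sF *%R fZ fg).
Qed.

(** The part of the staying event that is decided by time t, hence the part on
    which the noise at time t averages to zero. *)
Definition stay_until T t : set Omega :=
  [set w | forall s, (T <= s <= t)%N -> N (x s w, y s w)].

Lemma history_stay_until T t : F t (stay_until T t).
Proof.
have sF := history_sigma_algebra x y t.
pose B s := if (T <= s <= t)%N then [set w | N (x s w, y s w)] else setT.
have -> : stay_until T t = ~` (\bigcup_s ~` B s).
  apply/seteqP; split=> w /= h.
    by move=> [s _]; apply; rewrite /B; case: ifP => // st; exact: h.
  move=> s st; apply: contrapT => nN; apply: h; exists s => //=.
  by rewrite /B st.
apply: (sigmaC sF); case: sF => F0 FC FU; apply: FU => s.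
apply: (sigmaC (history_sigma_algebra x y t)); rewrite /B; case: ifP => [/andP[_ st]|_].
  have [fx fy] := lfp_adapted lfp st.
  exact: (finite_rv_preimage (history_sigma_algebra x y t) N
    (finite_rv_pair (history_sigma_algebra x y t) fx fy)).
exact: (sigmaT (history_sigma_algebra x y t)).
Qed.

Lemma Ex_noise_stay_until T t :
  Ex P (fun w => \1_(stay_until T t) w * gap_noise t w) = 0.
Proof.
have sF := history_sigma_algebra x y t.
have [fx fy] := lfp_adapted lfp (leqnn t).
have fB : finite_rv (F t) (\1_(stay_until T t) : Omega -> R).
  by apply: (finite_rv_indic sF); exact: history_stay_until.
pose Zx i w := \1_(stay_until T t) w * (eta * gap_grad_x A eta (x t w) i 0).
pose Zy j w := \1_(stay_until T t) w * (eta * gap_grad_y A eta (y t w) j 0).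
pose dx i := increment (fun t => I t.+1 @^-1` [set i])
  (fun t w => logit_x A eta (y t w) i 0) t.
pose dy j := increment (fun t => J t.+1 @^-1` [set j])
  (fun t w => logit_y A eta (x t w) j 0) t.
have fZx i : finite_rv (F t) (Zx i).
  exact: (finite_rv_op sF (fun a v => a * (eta * gap_grad_x A eta v i 0)) fB fx).
have fZy j : finite_rv (F t) (Zy j).
  exact: (finite_rv_op sF (fun a v => a * (eta * gap_grad_y A eta v j 0)) fB fy).
have mI i : measurable (I t.+1 @^-1` [set i]) by exact: (lfp_measI lfp).
have mJ j : measurable (J t.+1 @^-1` [set j]) by exact: (lfp_measJ lfp).
have FM := history_measurable lfp (t:=t).
have fdx i : finite_rv measurable (fun w => Zx i w * dx i w).
  apply: (finite_rv_op sM *%R (finite_rv_sub FM (fZx i))).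
  apply: (finite_rv_op sM (fun u v : R => u - v)); first exact: finite_rv_indic.
  exact: finite_rv_sub FM (finite_rv_logit_x lfp t i).
have fdy j : finite_rv measurable (fun w => Zy j w * dy j w).
  apply: (finite_rv_op sM *%R (finite_rv_sub FM (fZy j))).
  apply: (finite_rv_op sM (fun u v : R => u - v)); first exact: finite_rv_indic.
  exact: finite_rv_sub FM (finite_rv_logit_y lfp t j).
have -> : (fun w => \1_(stay_until T t) w * gap_noise t w)
   = (fun w => \sum_i Zx i w * dx i w + \sum_j Zy j w * dy j w).
  apply/funext => w; rewrite /gap_noise mulrA mulrDr /dot !mulr_sumr.
  congr (_ + _); apply: eq_bigr => l _.
  - rewrite /Zx /dx /increment -(stdvecE l (erefl (I t.+1 w))) colB; ring.
  - rewrite /Zy /dy /increment -(stdvecE l (erefl (J t.+1 w))) colB; ring.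
rewrite ExD; [|exact: finite_rv_sum|exact: finite_rv_sum].
rewrite !Ex_sum// !big1 ?addr0// => l _.
- apply: Ex_past_increment => //; first exact: (lfp_condJ lfp).
  exact: (finite_rv_logit_y lfp).
- apply: Ex_past_increment => //; first exact: (lfp_condI lfp).
  exact: (finite_rv_logit_x lfp).
Qed.

(** The staying event depends on the future, so the noise does not average to
    zero on it.  It does on [stay_until T t], and the two events differ only
    on paths that escape after time t. *)
Lemma Ex_noise_stay (b : R) T t : 0 <= b ->
  (forall t w, N (x t w, y t w) -> `|gap_noise t w| <= b) -> (T <= t)%N ->
  Ex P (fun w => \1_(stay T) w * gap_noise t w) <= b * fine (P (~` stay t)).
Proof.
move=> b0 bP Tt.
have mU : measurable (stay_until T t).
  by apply: (history_measurable lfp (t:=t)); exact: history_stay_until.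
have mS k : measurable (stay k) by exact: (measurable_stay lfp).
have fn := finite_rv_gap_noise t.
have fc : finite_rv measurable (fun w => b * \1_(~` stay t) w).
  apply: (finite_rv_comp ( *%R b)); apply: finite_rv_indic => //.
  exact: measurableC.
rewrite -Ex_indic; last exact: measurableC.
rewrite -ExZl; last by apply: finite_rv_indic => //; exact: measurableC.
rewrite -[leRHS]add0r -(Ex_noise_stay_until T t) -ExD//; last exact: finite_rv_mul_indic.
apply: le_Ex.
- exact: finite_rv_mul_indic.
- exact: (finite_rv_op sM +%R (finite_rv_mul_indic mU fn) fc).
move=> w; rewrite !indicE.
have stayU : w \in stay T -> w \in stay_until T t.
  move=> /set_mem h; apply/mem_set => s /andP[Ts _]; exact: h.
have ge0 (c : bool) : 0 <= b * c%:R by rewrite mulr_ge0.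
case: (boolP (w \in stay T)) => [wT|nT].
  by rewrite stayU// lerDl.
rewrite mul0r; case: (boolP (w \in stay_until T t)) => [/set_mem wU|_]; last first.
  by rewrite mul0r add0r.
have wt : w \in ~` stay t.
  apply/mem_set => /= wt; move/negP: nT; apply; apply/mem_set => s Ts.
  have [st|/ltnW ts] := leqP s t; last exact: wt.
  by apply: wU; rewrite Ts.
rewrite wt mul1r mulr1 -lerBlDr sub0r.
have : `|gap_noise t w| <= b by apply: bP; apply: wU; rewrite Tt leqnn.
by rewrite ler_norml => /andP[].
Qed.

Lemma Ex_gap_step T t : (T <= t)%N ->
  Ex P (fun w => \1_(stay T) w * gap_at t.+1 w) <=
  (1 - step t) * Ex P (fun w => \1_(stay T) w * gap_at t w)
  + step t * Ex P (fun w => \1_(stay T) w * gap_noise t w)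
  + C * fine (P (stay T)) * step t ^+ 2.
Proof.
move=> Tt; have mS : measurable (stay T) by exact: (measurable_stay lfp).
have f1 := finite_rv_mul_indic mS (finite_rv_gap_at t).
have f2 := finite_rv_mul_indic mS (finite_rv_gap_noise t).
have f3 : finite_rv measurable (\1_(stay T) : Omega -> R) by exact: finite_rv_indic.
have g1 := finite_rv_comp ( *%R (1 - step t)) f1.
have g2 := finite_rv_comp ( *%R (step t)) f2.
have g3 := finite_rv_comp ( *%R (C * step t ^+ 2)) f3.
have g12 := finite_rv_op sM +%R g1 g2.
have -> : C * fine (P (stay T)) * step t ^+ 2
    = C * step t ^+ 2 * Ex P \1_(stay T) by rewrite Ex_indic//; ring.
rewrite -(ExZl P _ f1) -(ExZl P _ f2) -(ExZl P _ f3) -ExD// -ExD//.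
apply: le_Ex; first exact: finite_rv_mul_indic mS (finite_rv_gap_at t.+1).
  exact: (finite_rv_op sM +%R g12 g3).
move=> w; rewrite indicE; case: (boolP (w \in stay T)) => [/set_mem wT|_].
  rewrite !mul1r !mulr1; apply: gap_drift; apply: wT => //.
  exact: leq_trans (leqnSn t).
by rewrite !mul0r !mulr0 !addr0.
Qed.

(** Compares with the telescoping series 8 D / s. *)
Lemma sum_inv_square_le (D : R) T t : 0 <= D -> (0 < T)%N ->
  \sum_(T <= s < t) 2 * (s%:R + 1) * (D / s%:R ^+ 3) <= 8 * D.
Proof.
move=> D0 T0.
have TR : 1 <= T%:R :> R by rewrite ler1n.
have [tT|Tt] := leqP t T; first by rewrite big_geq// mulr_ge0.
pose f s : R := - (8 * D / s%:R).
apply: (@le_trans _ _ (\sum_(T <= s < t) (f s.+1 - f s))).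
  rewrite big_nat [leRHS]big_nat; apply: ler_sum => s /andP[Ts _].
  have s1 : 1 <= s%:R :> R by rewrite ler1n (leq_trans T0).
  rewrite /f -[s.+1%:R]natr1; move: (s%:R) s1 => u u1.
  have u0 : 0 < u by lra.
  rewrite -subr_ge0.
  have -> : - (8 * D / (u + 1)) - - (8 * D / u) - 2 * (u + 1) * (D / u ^+ 3)
     = 2 * D * (4 * u ^+ 2 - (u + 1) ^+ 2) / (u ^+ 3 * (u + 1)).
    by field; rewrite !gt_eqF//; lra.
  have -> : 4 * u ^+ 2 - (u + 1) ^+ 2 = (u - 1) * (3 * u + 1) by ring.
  by rewrite divr_ge0 ?mulr_ge0 ?exprn_ge0//; lra.
rewrite telescope_sumr; last exact: ltnW.
rewrite /f opprK addrC.
have tR : 0 < t%:R :> R by rewrite ltr0n (leq_trans T0)// ltnW.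
apply: (@le_trans _ _ (8 * D / T%:R)).
  by rewrite gerBl divr_ge0 ?mulr_ge0 ?(ltW tR).
by rewrite ler_pdivrMr ?(lt_le_trans ltr01)// ler_peMr// mulr_ge0.
Qed.

(** The gap recursion integrated over the staying event; D collects all the
    noise that is due to conditioning on the future, uniformly in T and t. *)
Lemma Ex_gap_bound (r : R) : 0 < r ->
  (forall p, coord_close r p xs -> \sum_i p i 0 = 1 -> l1ball xs rx p) ->
  (forall q, coord_close r q ys -> \sum_j q j 0 = 1 -> l1ball ys ry q) ->
  exists K D : R, [/\ 0 <= K, 0 <= D,
  forall t, (0 < t)%N -> fine (P (~` stays_close x y xs ys r t)) <= K / t%:R ^+ 3,
  forall t, stays_close x y xs ys r t `<=` stay t &
  forall T t, (0 < T)%N -> (T <= t)%N ->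
  t%:R * (t%:R + 1) * Ex P (fun w => \1_(stay T) w * gap_at t w) <=
  T%:R * (T%:R + 1) * Ex P (fun w => \1_(stay T) w * gap_at T w) + D
  + 4 * (C * fine (P (stay T))) * (t%:R - T%:R)].
Proof.
move=> r0 clx cly.
have [K K0 esc] := escape_tail eta0 lfp fp r0.
have [b b0 bP] := gap_noise_bound.
exists K, (8 * (b * K)).
have closeN t : stays_close x y xs ys r t `<=` stay t.
  move=> w h s ts; have [h1 h2] := h s ts.
  by have [[_ sx] [_ sy]] := lfp_simplex lfp s w; split; [exact: clx|exact: cly].
split=> //; first by rewrite !mulr_ge0.
move=> T t T0 Tt; have mS k : measurable (stay k) by exact: (measurable_stay lfp).
have kap0 : 0 <= kappa by rewrite divr_ge0 ?sqr_ge0.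
have C0 : 0 <= C * fine (P (stay T)).
  rewrite mulr_ge0 ?fine_P_ge0// mulr_ge0 ?mulr_ge0 ?(ltW eta0)//.
  by rewrite !addr_ge0// mulr_ge0.
have := @weighted_recursion R (fun t => Ex P (fun w => \1_(stay T) w * gap_at t w))
  (fun t => Ex P (fun w => \1_(stay T) w * gap_noise t w)) _ T t C0 Tt
  (fun s st => Ex_gap_step (proj1 (andP st))).
move=> /le_trans; apply; rewrite lerD2r lerD2l.
apply: le_trans (sum_inv_square_le t (mulr_ge0 b0 K0) T0).
rewrite big_nat [leRHS]big_nat; apply: ler_sum => s /andP[Ts _].
have s0 : (0 < s)%N by exact: leq_trans Ts.
apply: ler_wpM2l; first by rewrite mulr_ge0 ?addr_ge0.
apply: le_trans (Ex_noise_stay b0 bP Ts) _; rewrite -mulrA ler_wpM2l//.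
apply: le_trans (esc _ s0); apply: fine_P_mono; first exact: measurableC.
  by apply: measurableC; rewrite stays_closeE; exact: (measurable_stay lfp).
exact/subsetC/closeN.
Qed.

(** A radius small enough for the ball constraints and for the gap to be at
    most e. *)
Lemma stay_radius (e : R) : 0 < e -> exists r : R, [/\ 0 < r,
  (forall p, coord_close r p xs -> \sum_i p i 0 = 1 -> l1ball xs rx p),
  (forall q, coord_close r q ys -> \sum_j q j 0 = 1 -> l1ball ys ry q) &
  forall p q, coord_close r p xs -> coord_close r q ys ->
    \sum_i p i 0 = 1 -> \sum_j q j 0 = 1 -> duality_gap A eta p q <= e].
Proof.
move=> e0; have nR : 0 < n%:R :> R by rewrite ltr0n.
have mR : 0 < m%:R :> R by rewrite ltr0n.
have kap0 : 0 <= kappa by rewrite divr_ge0 ?sqr_ge0.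
have eta2 : 0 <= eta / 2 by rewrite divr_ge0 ?(ltW eta0).
pose Q := eta / 2 * ((Lx + kappa) * n%:R ^+ 2 + (Ly + kappa) * m%:R ^+ 2).
have Q0 : 0 <= Q.
  by rewrite mulr_ge0// addr_ge0// mulr_ge0 ?exprn_ge0// addr_ge0.
have Q1 : 0 < Q + 1 by rewrite ltr_wpDl.
pose r := Num.min (Num.min (rx / n%:R) (ry / m%:R)) (Num.min 1 (e / (Q + 1))).
have r0 : 0 < r by rewrite !lt_min !divr_gt0// ltr01.
have rrx : n%:R * r <= rx by rewrite mulrC -ler_pdivlMr// !ge_min lexx.
have rry : m%:R * r <= ry by rewrite mulrC -ler_pdivlMr// !ge_min lexx orbT.
have r1 : r <= 1 by rewrite !ge_min lexx !orbT.
have re : r * (Q + 1) <= e by rewrite -ler_pdivlMr// !ge_min lexx !orbT.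
have ball_x p : coord_close r p xs -> \sum_i p i 0 = 1 -> l1ball xs rx p.
  by move=> /coord_close_l1norm pr p1; split=> //; exact: le_trans rrx.
have ball_y q : coord_close r q ys -> \sum_j q j 0 = 1 -> l1ball ys ry q.
  by move=> /coord_close_l1norm qr q1; split=> //; exact: le_trans rry.
exists r; split=> // p q pc qc p1 q1.
have [sxs sys] := nbhd_xs_ys.
have Bxs := l1ball_center hrx sxs; have Bys := l1ball_center hry sys.
have hx := smooth_on_negent hLx Bxs (ball_x _ pc p1) (relint_gt0 (l1ball_relint_x Bxs)).
have hy := smooth_on_negent hLy Bys (ball_y _ qc q1) (relint_gt0 (l1ball_relint_y Bys)).
apply: le_trans (gap_quadratic eta0 n0 m0 fp p1 q1 hx hy) _.
have sq k (u : 'cV[R]_k) : l1norm u <= k%:R * r -> l1norm u ^+ 2 <= k%:R ^+ 2 * r.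
  move=> ur; apply: (@le_trans _ _ ((k%:R * r) ^+ 2)).
    by rewrite lerXn2r ?nnegrE ?l1norm_ge0 ?mulr_ge0// ltW.
  by rewrite exprMn ler_wpM2l ?exprn_ge0// expr2 ler_piMr// ltW.
apply: (@le_trans _ _ (Q * r)); last first.
  by apply: le_trans re; rewrite mulrC ler_pM2l// lerDl.
rewrite /Q -[leRHS]mulrA; apply: ler_wpM2l => //.
have -> : ((Lx + kappa) * n%:R ^+ 2 + (Ly + kappa) * m%:R ^+ 2) * r
  = (Lx + kappa) * (n%:R ^+ 2 * r) + (Ly + kappa) * (m%:R ^+ 2 * r) by ring.
by apply: lerD; apply: ler_wpM2l; rewrite ?addr_ge0//; apply: sq;
  exact: coord_close_l1norm.
Qed.

(** The constant D of [Ex_gap_bound] is absorbed by the initial term: for large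
    T the gap at time T is on average at most about half its maximum on the
    staying event, which leaves a margin of order T^2 times the maximum.  If
    the maximum is zero the gap vanishes and there is nothing to absorb. *)
Lemma exists_stay_time (delta : R) : 0 < delta -> exists T : nat,
  [/\ 1 - delta <= fine (P (stay T)), 0 < fine (P (stay T)) &
   forall t, (T < t)%N ->
   t%:R * (t%:R + 1) * Ex P (fun w => \1_(stay T) w * gap_at t w) <=
   (T%:R * (T%:R + 1) * gmax + 4 * C * (t%:R - T%:R)) * fine (P (stay T))].
Proof.
move=> delta0.
have kap0 : 0 <= kappa by rewrite divr_ge0 ?sqr_ge0.
have C0 : 0 <= C.
  by rewrite mulr_ge0 ?mulr_ge0 ?(ltW eta0)// !addr_ge0// mulr_ge0.
(* the value 1 is a placeholder for the degenerate case gmax = 0 *)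
pose e := if 0 < gmax then gmax / 2 else 1.
have e0 : 0 < e by rewrite /e; case: ifP => // g0; rewrite divr_gt0.
have [r [r0 clx cly small]] := stay_radius e0.
have [K [D [K0 D0 esc closeN bound]]] := Ex_gap_bound r0 clx cly.
(* the three terms bound the escape probability q by delta, q by 1/8, and D by
   an eighth of T (T + 1) gmax *)
pose S := K / delta + 8 * K + 8 * D / gmax.
have [T T0 TS] : exists2 T : nat, (0 < T)%N & `|S| <= T%:R.
  exists (Num.bound `|S|).+1 => //; apply: ltW.
  by apply: lt_trans (archi_boundP (normr_ge0 _)) _; rewrite ltr_nat.
have T1 : 1 <= T%:R :> R by rewrite ler1n.
have Tpos : 0 < T%:R :> R by rewrite ltr0n.
have mS k : measurable (stay k) by exact: (measurable_stay lfp).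
have mC k : measurable (stays_close x y xs ys r k).
  by rewrite stays_closeE; exact: (measurable_stay lfp).
set p := fine (P (stay T)).
have escT := esc T T0.
set q := fine (P (~` stays_close x y xs ys r T)) in escT.
have pq : 1 - q <= p.
  rewrite /q fine_PC// opprB addrCA subrr addr0.
  exact: fine_P_mono.
have qT : q * T%:R <= K.
  have : q * T%:R ^+ 3 <= K by rewrite -ler_pdivlMr// exprn_gt0.
  apply: le_trans; rewrite ler_wpM2l ?fine_P_ge0//.
  by rewrite ler_eXnr.
have gm0 : 0 <= gmax.
  have [sxs sys] := nbhd_xs_ys.
  apply: le_trans (gap_le_max A eta0 n0 m0 sxs sys).
  by rewrite (gap_fixed_point eta0 n0 m0 fp).
have g80 : 0 <= 8 * D / gmax by rewrite divr_ge0 ?mulr_ge0.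
have S0 : S <= T%:R by apply: le_trans TS; exact: ler_norm.
have Kd0 : 0 <= K / delta by rewrite divr_ge0 ?(ltW delta0).
have K80 : 0 <= 8 * K by rewrite mulr_ge0.
have Sd : K / delta <= T%:R.
  by apply: le_trans S0; rewrite /S -addrA lerDl addr_ge0.
have S8 : 8 * K <= T%:R.
  by apply: le_trans S0; rewrite /S addrAC lerDr addr_ge0.
have Sg : 8 * D / gmax <= T%:R by apply: le_trans S0; rewrite /S lerDr addr_ge0.
have qd : q <= delta.
  rewrite -(ler_pM2r Tpos); apply: le_trans qT _.
  by rewrite mulrC -ler_pdivrMr.
have q8 : 8 * q <= 1.
  rewrite -(ler_pM2r Tpos) mul1r -mulrA; apply: le_trans S8.
  by rewrite ler_pM2l.
exists T; split; rewrite -/p; [lra|lra|].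
move=> t Tt.
have tR : 0 < t%:R :> R by rewrite ltr0n (leq_trans T0)// ltnW.
have TtR : 0 <= t%:R - T%:R :> R by rewrite subr_ge0 ler_nat ltnW.
have p0 : 0 <= p by exact: fine_P_ge0.
have le_gmax s w : gap_at s w <= gmax.
  by have [sx sy] := lfp_simplex lfp s w; exact: gap_le_max.
have f1 s := finite_rv_mul_indic (mS T) (finite_rv_gap_at s).
have fS : finite_rv measurable (\1_(stay T) : Omega -> R) by exact: finite_rv_indic.
have [gpos|gneg] := ltP 0 gmax; last first.
  have g00 : gmax = 0 by apply/eqP; rewrite eq_le gneg gm0.
  have E0 : Ex P (fun w => \1_(stay T) w * gap_at t w) <= 0.
    rewrite -[leRHS](Ex_cst P); apply: le_Ex => //; first exact: finite_rv_cst.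
    by move=> w; rewrite mulr_ge0_le0 ?indicE// -g00.
  apply: (@le_trans _ _ 0); first by rewrite mulr_ge0_le0// mulr_ge0 ?addr_ge0.
  by rewrite g00 mulr0 add0r mulr_ge0// mulr_ge0// mulr_ge0.
have eE : e = gmax / 2 by rewrite /e gpos.
have ET : Ex P (fun w => \1_(stay T) w * gap_at T w) <= gmax / 2 * p + gmax * q.
  rewrite /p /q -!Ex_indic//; last exact: measurableC.
  have fC : finite_rv measurable (\1_(~` stays_close x y xs ys r T) : Omega -> R).
    by apply: finite_rv_indic => //; exact: measurableC.
  have h1 := finite_rv_comp ( *%R (gmax / 2)) fS.
  have h2 := finite_rv_comp ( *%R gmax) fC.
  rewrite -!ExZl// -ExD//; apply: le_Ex => //; first exact: (finite_rv_op sM +%R h1 h2).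
  move=> w; rewrite !indicE; case: (boolP (w \in ~` _)) => [_|/negP wC].
    rewrite mulr1; case: (w \in stay T); last by rewrite mul0r mulr0 add0r ltW.
    rewrite mul1r mulr1; apply: le_trans (le_gmax T w) _.
    by rewrite lerDr divr_ge0.
  rewrite mulr0 addr0; case: (w \in stay T); last by rewrite mul0r mulr0.
  rewrite mul1r mulr1 -eE.
  have wc : stays_close x y xs ys r T w.
    by apply: contrapT => nw; apply: wC; exact/mem_set.
  have [h3 h4] := wc T (leqnn T).
  by have [[_ sx] [_ sy]] := lfp_simplex lfp T w; exact: small.
apply: le_trans (bound T t T0 (ltnW Tt)) _.
rewrite [leRHS]mulrDl -/p.
have -> : 4 * (C * p) * (t%:R - T%:R) = 4 * C * (t%:R - T%:R) * p by ring.
rewrite lerD2r.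
have TT0 : 0 <= T%:R * (T%:R + 1) :> R by rewrite mulr_ge0 ?addr_ge0.
apply: (@le_trans _ _ (T%:R * (T%:R + 1) * (gmax / 2 * p + gmax * q) + D)).
  by rewrite lerD2r ler_wpM2l.
have TT : T%:R <= T%:R * (T%:R + 1) :> R by rewrite ler_peMr ?(ltW Tpos)// lerDr.
have DT : 8 * D <= T%:R * (T%:R + 1) * gmax.
  rewrite -ler_pdivrMr//; exact: le_trans Sg TT.
have p78 : 7 <= 8 * p by lra.
have : 0 <= T%:R * (T%:R + 1) * gmax by rewrite mulr_ge0.
have -> : T%:R * (T%:R + 1) * (gmax / 2 * p + gmax * q)
   = T%:R * (T%:R + 1) * gmax * (p / 2 + q) by ring.
move: DT; move: (T%:R * (T%:R + 1) * gmax) => X DX X0.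
have X1 : X * q * 8 <= X by rewrite -mulrA ler_piMr// mulrC.
have X2 : 7 * X <= X * p * 8 by rewrite -mulrA (mulrC p) [leRHS]mulrC ler_wpM2r.
have -> : X * (p / 2 + q) = X * p - X * p / 2 + X * q by field.
have : X * p / 2 * 2 = X * p by field.
move: (X * p / 2) (X * p) (X * q) X1 X2 => u v z *; lra.
Qed.

End Conditioning.

Unset Implicit Arguments.

Theorem theorem4p2 (R : realType) (m n : nat) (A : 'M[R]_(m, n)) (eta : R)
    (heta : 0 < eta)
    (xs : 'cV[R]_n) (ys : 'cV[R]_m)
    (hxs : relint (simplex n) xs) (hys : relint (simplex m) ys)
    (hfix : fixed_point A eta xs ys)
    (rx ry : R) (hrx : 0 < rx) (hry : 0 < ry)
    (hN : nbhd xs ys rx ry `<=` relint (simplex n) `*` relint (simplex m))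
    (Lx Ly : R) (hLx0 : 0 <= Lx) (hLy0 : 0 <= Ly)
    (hLx : smooth_on negent (l1ball xs rx) Lx)
    (hLy : smooth_on negent (l1ball ys ry) Ly)
    (d : measure_display) (Omega : measurableType d) (P : probability Omega R)
    (i0 : 'I_n) (j0 : 'I_m)
    (I : nat -> Omega -> 'I_n) (J : nat -> Omega -> 'I_m)
    (x : nat -> Omega -> 'cV[R]_n) (y : nat -> Omega -> 'cV[R]_m)
    (hlfp : is_lfp P x y A eta (fun t => 2 / (t%:R + 2)) i0 j0 I J)
    (delta : R) (hdelta : 0 < delta < 1) :
  exists T : nat,
    ((1 - delta)%:E <= P (stay_event x y (nbhd xs ys rx ry) T))%E /\
    forall t : nat, (T + 1 <= t)%N ->
      (cond_expectation P (fun w => duality_gap A eta (x t w) (y t w))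
         (stay_event x y (nbhd xs ys rx ry) T)
       <= (T%:R * (T%:R + 1) / (t%:R * (t%:R + 1)) * duality_gap_max A eta
           + 8 * eta * (Lx + Ly + 2 * (norm_1oo A ^+ 2 / eta ^+ 2))
             * (t%:R - T%:R) / (t%:R * (t%:R + 1)))%:E)%E.
Proof.
have /andP[delta0 _] := hdelta.
have [T [PT PT0 bound]] := exists_stay_time heta hlfp hfix hrx hry hN
  hLx0 hLy0 hLx hLy delta0.
have mS : measurable (stay_event x y (nbhd xs ys rx ry) T).
  exact: (measurable_stay hlfp).
exists T; split; first by rewrite -[leRHS]fineK ?lee_fin// fin_num_measure.
move=> t; rewrite addn1 => Tt; rewrite /cond_expectation.
have int := finite_rv_integrable P mS (finite_rv_gap_at hlfp t).
rewrite -[(\int[P]_(w in _) _)%E]fineK; last exact: (integrable_fin_num mS int).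
rewrite -[fine (integral _ _ _)]/(Rintegral P _ (fun w => gap_at A eta x y t w)).
rewrite -Ex_restrict -EFinM lee_fin mulrC ler_pdivrMr//.
have tR : 0 < t%:R :> R by rewrite ltr0n (leq_ltn_trans (leq0n T)).
have tt0 : 0 < t%:R * (t%:R + 1) :> R by rewrite mulr_gt0 ?addr_gt0.
rewrite -(ler_pM2l tt0); apply: le_trans (bound t Tt) _.
rewrite le_eqVlt; apply/orP; left; apply/eqP; field.
by rewrite !gt_eqF// addr_gt0.
Qed.
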